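(* Let $0\le k\le n$ and let $D$ be an $n$-diagram such that $D\otimes 1$ belongs to the diagrammatic basis of $\operatorname{Ind}_{\mathrm{TL}_k\otimes\mathrm{TL}_{n-k}}^{\mathrm{TL}_n}\mathbb K_{\mathrm{triv}}$. Then the dual canonical basis element of $V^{\otimes n}$ corresponding to $D$ is equal to $$\sum_{I\in T(D)}\operatorname{sgn}(I)\,v_I .$$
   Context: Let $q$ be an indeterminate, $\mathbb K=\mathbb C(q)$, and let $a\mapsto\bar a$ be the $\mathbb C$-linear field automorphism of $\mathbb K$ with $\bar q=q^{-1}$. Temperley-Lieb algebra. An $n$-diagram consists of two parallel horizontal lines (bottom and top) with $n$ vertices each, the $2n$ vertices being joined in pairs by pairwise non-crossing edges (''links'') drawn between the lines, up to homotopy. $\mathrm{TL}_n$ is the $\mathbb K$-algebra with basis the $n$-diagrams; the product $D'D$ is obtained by stacking $D'$ on top of $D$ and replacing each closed loop by the factor $-q-q^{-1}$. It is generated by $e_1,\dots,e_{n-1}$, where $e_i$ joins the $i$th and $(i+1)$th vertices from the left on the bottom line, likewise on the top line, and has vertical links elsewhere. Action. $V=\mathbb K v_+\oplus\mathbb K v_-$. Let $\epsilon:V\otimes V\to\mathbb K$, $v_+\otimes v_+\mapsto 0$, $v_+\otimes v_-\mapsto -q$, $v_-\otimes v_+\mapsto 1$, $v_-\otimes v_-\mapsto 0$, and $\delta:\mathbb K\to V\otimes V$, $1\mapsto v_+\otimes v_- -q^{-1}v_-\otimes v_+$. $\mathrm{TL}_n$ acts on $V^{\otimes n}$ by $e_i\mapsto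 \mathrm{id}^{\otimes(i-1)}\otimes(\delta\circ\epsilon)\otimes\mathrm{id}^{\otimes(n-i-1)}$. Induced modules. $\mathrm{TL}_k\otimes\mathrm{TL}_{n-k}\subseteq\mathrm{TL}_n$ is the subalgebra generated by the $e_i$ with $i\ne k$; $\mathbb K_{\mathrm{triv}}$ is its one-dimensional module on which all these $e_i$ act by $0$; $\operatorname{Ind}$ denotes $\mathrm{TL}_n\otimes_{\mathrm{TL}_k\otimes\mathrm{TL}_{n-k}}(-)$. The diagrammatic basis consists of the $D\otimes1$, where $D$ runs over the $n$-diagrams having no link joining two of the $k$ leftmost bottom vertices and no link joining two of the $n-k$ rightmost bottom vertices. The dual canonical basis element corresponding to $D$ is the image of $D\otimes 1$ under the $\mathrm{TL}_n$-module embedding $\operatorname{Ind}_{\mathrm{TL}_k\otimes\mathrm{TL}_{n-k}}^{\mathrm{TL}_n}\mathbb K_{\mathrm{triv}}\hookrightarrow V^{\otimes n}$, $g\otimes1\mapsto g\cdot(v_-^{\otimes k}\otimes v_+^{\otimes(n-k)})$, which sends the diagrammatic basis into the dual canonical basis. Dual canonical basis. Let $K,E,F$ act on $V$ by $K v_\pm=q^{\pm1}v_\pm$, $Ev_+=0$, $Ev_-=v_+$, $Fv_+=v_-$, $Fv_-=0$, and let $F$ act on $V^{\otimes m}$ by $\sum_{j=1}^m 1^{\otimes(j-1)}\otimes F\otimes K^{\otimes(m-j)}$. The bar involution $\psi_m$ of $V^{\otimes m}$ is the antilinear map ($\psi_m(ax)=\bar a\psi_m(x)$) determined by $\psi_1(v_\pm)=v_\pm$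 and $\psi_m(x\otimes v)=\psi_{m-1}(x)\otimes v+(q-q^{-1})\,F\psi_{m-1}(x)\otimes Ev$ for $x\in V^{\otimes(m-1)}$, $v\in\{v_+,v_-\}$. The dual canonical basis element $v_{k_n}\heartsuit\cdots\heartsuit v_{k_1}$ ($k_i\in\{+,-\}$) is the unique element fixed by $\psi_n$ such that $v_{k_n}\heartsuit\cdots\heartsuit v_{k_1}-v_{k_n}\otimes\cdots\otimes v_{k_1}$ is a $q^{-1}\mathbb Z[q^{-1}]$-linear combination of vectors $v_{l_n}\otimes\cdots\otimes v_{l_1}$ with $\sum_{i=1}^n l_i=\sum_{i=1}^n k_i$ and $\sum_{i=1}^{n'}l_i\ge\sum_{i=1}^{n'}k_i$ for $1\le n'\le n$ (reading $\pm$ as $\pm1$). Notation in the formula. Number the vertices of both lines of $D$, and the tensor components of $V^{\otimes n}$, by $1,\dots,n$ from RIGHT to LEFT. Let $C(D)$ be the set of two-element subsets $\{i,j\}\subseteq\{1,\dots,n\}$ such that the top vertices $i$ and $j$ are joined by a link of $D$, and let $m=|C(D)|$. $T(D)$ is the set of $m$-element subsets $S\subseteq\{1,\dots,n\}$ with $|S\cap C|=1$ for every $C\in C(D)$. For $S\in T(D)$, $\operatorname{sgn}(S)=(-q^{-1})^{c(S)}$, where $c(S)=|\{C\in C(D): S\cap C=\{\min C\}\}|$. For $I\in T(D)$, $v_I\in V^{\otimes n}$ is the standard basis vector (tensor product of $v_\pm$'s) defined as follows: if a link of $D$ joins a bottom vertex to the top vertex $j$, the $j$th component of $v_I$ is $v_-$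 if that bottom vertex is among the $k$ leftmost bottom vertices and $v_+$ otherwise; every other component $i$ is $v_+$ if $i\in I$ and $v_-$ otherwise. *)

(* Defs.v *)
From HB Require Import structures.
From mathcomp Require Import all_boot all_order all_algebra.
From mathcomp Require Import reals complex zify.

Set Implicit Arguments.
Unset Strict Implicit.
Unset Printing Implicit Defensive.

Import GRing.Theory.
Local Open Scope ring_scope.
Local Open Scope quotient_scope.

(* The ground field K = C(q); C is R[i] for an arbitrary model R of the real  *)
(* numbers.                                                                   *)
Notation groundField R := {fraction {poly R[i]}}.

Section GroundField.
Variable R : realType.
Local Notation K := (groundField R).

Definition cst (c : R[i]) : K := FracField.tofrac c%:P.
Definition q : K := FracField.tofrac 'X.

Lemma cst_zmod_morphism : zmod_morphism cst.
Proof. by move=> a b; rewrite /cst !rmorphB. Qed.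
Lemma cst_monoid_morphism : monoid_morphism cst.
Proof. by split=> [|a b]; rewrite /cst ?rmorph1 ?rmorphM. Qed.
HB.instance Definition _ :=
  GRing.isZmodMorphism.Build R[i] K cst cst_zmod_morphism.
HB.instance Definition _ :=
  GRing.isMonoidMorphism.Build R[i] K cst cst_monoid_morphism.

(* p(q) |-> p(q^-1) on C[q] *)
Definition barp (p : {poly R[i]}) : K := (map_poly cst p).[q^-1].

Definition bar (a : K) : K := barp \n_(repr a) / barp \d_(repr a).

Lemma barpM a b : barp (a * b) = barp a * barp b.
Proof. by rewrite /barp rmorphM hornerM. Qed.
Lemma barpB a b : barp (a - b) = barp a - barp b.
Proof. by rewrite /barp rmorphB hornerD hornerN. Qed.
Lemma barp1 : barp 1 = 1.
Proof. by rewrite /barp rmorph1 hornerC. Qed.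

Lemma tofrac_poly n (E : nat -> R[i]) :
  FracField.tofrac (\poly_(i < n) E i) = \sum_(i < n) cst (E i) * q ^+ i.
Proof.
rewrite poly_def rmorph_sum; apply: eq_bigr => i _.
by rewrite -mul_polyC rmorphM rmorphXn.
Qed.

Lemma q_neq0 : q != 0.
Proof. by rewrite /q tofrac_eq0 polyX_eq0. Qed.

Lemma barp_neq0 p : p != 0 -> barp p != 0.
Proof.
move=> p0; apply/eqP => h.
have : FracField.tofrac (\poly_(i < size p) p`_((size p).-1 - i)) = 0.
  rewrite tofrac_poly -[RHS](mulr0 (q ^+ (size p).-1)) -[in RHS]h /barp.
  rewrite horner_coef mulr_sumr size_map_poly (reindex_inj rev_ord_inj) /=.
  apply: eq_bigr => i _; rewrite coef_map /=.
  case: i => i /= hi; have hs : (i <= (size p).-1)%N by case: (size p) hi.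
  have -> : (size p - i.+1 = (size p).-1 - i)%N by case: (size p) hi.
  rewrite subKn // mulrCA exprVn; congr (_ * _).
  by rewrite -{2}(subnK hs) exprD mulfK // expf_neq0 // q_neq0.
move/eqP; rewrite tofrac_eq0 => /eqP/(congr1 (fun r : {poly _} => r`_0)).
rewrite coef_poly coef0 size_poly_gt0 p0 subn0 -lead_coefE => /eqP.
by rewrite lead_coef_eq0 (negbTE p0).
Qed.

Lemma frac_repr (a : K) :
  a = FracField.tofrac \n_(repr a) / FracField.tofrac \d_(repr a).
Proof.
apply: (canRL (mulfK _)); first by rewrite tofrac_eq0 denom_ratioP.
rewrite -{1}[a]reprK; move: (repr a) => x.
unlock FracField.tofrac; rewrite -[LHS]FracField.pi_mul.
apply/eqmodP; rewrite /= FracField.equivfE /FracField.mulf /=.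
by rewrite !numden_Ratio ?mulr1 ?oner_neq0 ?denom_ratioP // mulrC.
Qed.

Lemma bar_div m d : d != 0 ->
  bar (FracField.tofrac m / FracField.tofrac d) = barp m / barp d.
Proof.
move=> d0; rewrite /bar.
set a := (X in repr X); have := frac_repr a; rewrite {1}/a.
have := denom_ratioP (repr a); move: (repr a) => [[m' d'] /= _] d'0 /eqP.
rewrite eqr_div ?tofrac_eq0 // -!rmorphM tofrac_eq => /eqP E.
by apply/eqP; rewrite eqr_div ?barp_neq0 // -!barpM -E mulrC.
Qed.

Lemma bar_cst c : bar (cst c) = cst c.
Proof.
rewrite -[cst c in LHS]divr1 -[1 in LHS](rmorph1 (@FracField.tofrac _)).
by rewrite bar_div ?oner_neq0 // barp1 divr1 /barp map_polyC hornerC.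
Qed.

Lemma bar_q : bar q = q^-1.
Proof.
rewrite -[q in LHS]divr1 -[1 in LHS](rmorph1 (@FracField.tofrac _)).
by rewrite bar_div ?oner_neq0 // barp1 divr1 /barp map_polyX hornerX.
Qed.

Lemma bar_zmod_morphism : zmod_morphism bar.
Proof.
move=> a b; rewrite {1}(frac_repr a) {1}(frac_repr b).
have da := denom_ratioP (repr a); have db := denom_ratioP (repr b).
rewrite -mulNr addf_div ?tofrac_eq0 // mulNr -!rmorphM -rmorphB.
rewrite bar_div ?mulf_neq0 // barpB !barpM /bar.
by rewrite -[in RHS]mulNr addf_div ?barp_neq0 // mulNr.
Qed.

Lemma bar_monoid_morphism : monoid_morphism bar.
Proof.
split=> [|a b]; first by rewrite -(rmorph1 cst) bar_cst.
rewrite {1}(frac_repr a) {1}(frac_repr b) mulf_div -!rmorphM.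
by rewrite bar_div ?mulf_neq0 ?denom_ratioP // !barpM -mulf_div.
Qed.

HB.instance Definition _ := GRing.isZmodMorphism.Build K K bar bar_zmod_morphism.
HB.instance Definition _ :=
  GRing.isMonoidMorphism.Build K K bar bar_monoid_morphism.

Lemma bar_tofrac p : bar (FracField.tofrac p) = barp p.
Proof.
rewrite -[FracField.tofrac p in LHS]divr1.
rewrite -[1 in LHS](rmorph1 (@FracField.tofrac _)) bar_div ?oner_neq0 //.
by rewrite barp1 divr1.
Qed.

Lemma barK : involutive bar.
Proof.
have barpK p : bar (barp p) = FracField.tofrac p.
  rewrite /barp horner_coef rmorph_sum /= size_map_poly -[in RHS](coefK p).
  rewrite tofrac_poly; apply: eq_bigr => i _.
  by rewrite coef_map rmorphM rmorphXn fmorphV /= bar_cst bar_q invrK.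
by move=> a; rewrite [bar a in LHS]/bar fmorph_div /= !barpK -frac_repr.
Qed.

End GroundField.

(* Conventions.  Vertices and tensor components are numbered from right to    *)
(* left, starting at 0: j : 'I_n is the (j+1)-st vertex from the right.  In a *)
(* pair (t, j), t = false means "bottom" and t = true means "top".  A sign is *)
(* a boolean, true standing for + and false for -.                            *)

Definition vertex n : Type := (bool * 'I_n)%type.
HB.instance Definition _ n := Finite.on (vertex n).

(* position in the cyclic order along the boundary of the strip               *)
Definition bpos n (v : vertex n) : nat :=
  if v.1 then ((2 * n).-1 - v.2)%N else v.2.

(* Up to homotopy, a diagram is a perfect matching of its vertices, i.e. a    *)
(* fixed point free involution, that is non-crossing.                         *)
Definition planar n (d : {ffun vertex n -> vertex n}) : bool :=
  [&& [forall v, d (d v) == v], [forall v, d v != v] &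
      [forall u, forall v,
        ~~ [&& bpos u < bpos v, bpos v < bpos (d u) & bpos (d u) < bpos (d v)]%N]].

Record diagram n := Diagram { link :> {ffun vertex n -> vertex n};
                              linkP : planar link }.
HB.instance Definition _ n := [isSub for @link n].
HB.instance Definition _ n := [Finite of diagram n by <:].

Definition id_link n : {ffun vertex n -> vertex n} := [ffun v => (~~ v.1, v.2)].

(* links between the vertices a and b on either line, and vertical links      *)
Definition gen_link n (a b : 'I_n) : {ffun vertex n -> vertex n} :=
  [ffun v => if v.2 == a then (v.1, b) else
             if v.2 == b then (v.1, a) else (~~ v.1, v.2)].

Lemma id_link_planar n : planar (id_link n).
Proof.
apply/and3P; split.
- by apply/forallP=> -[t i]; rewrite !ffunE /= negbK.
- by apply/forallP=> -[t i]; rewrite !ffunE /= xpair_eqE; case: t.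
- apply/forallP=> -[t i]; apply/forallP=> -[u j]; rewrite !ffunE /bpos /=.
  by case: t u i j => [] [] [i hi] [j hj] /=; lia.
Qed.

Lemma gen_link_planar n (a b : 'I_n) : b = a.+1 :> nat ->
  planar (gen_link a b).
Proof.
move=> ab; have abF : (b == a) = false by rewrite -val_eqE /= ab; lia.
have baF : (a == b) = false by rewrite eq_sym.
apply/and3P; split.
- apply/forallP=> -[t i]; rewrite !ffunE /=.
  case: (eqVneq i a) => [->|ia] /=; first by rewrite abF eqxx.
  by case: (eqVneq i b) => [->|ib] /=; rewrite ?eqxx // (negbTE ia) (negbTE ib) negbK.
- apply/forallP=> -[t i]; rewrite !ffunE /=.
  case: (eqVneq i a) => [->|ia] /=; first by rewrite xpair_eqE abF andbF.
  case: (eqVneq i b) => [->|ib] /=; first by rewrite xpair_eqE baF andbF.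
  by rewrite xpair_eqE; case: t.
- apply/forallP=> -[t i]; apply/forallP=> -[u j]; rewrite !ffunE /bpos /=.
  rewrite -!val_eqE.
  case: a b i j ab {abF baF} => [a ha] [b hb] [i hi] [j hj] /= e.
  case: (eqVneq i a) => ? /=; case: (eqVneq i b) => ? /=;
  case: (eqVneq j a) => ? /=; case: (eqVneq j b) => ? /=;
  by case: t u => [] []; rewrite /=; lia.
Qed.

Definition id_diagram n : diagram n := Diagram (id_link_planar n).

(* Here b is the left neighbour of a; counting from the left, this is the     *)
(* diagram e_(n - b).                                                         *)
Definition gen_diagram n (a b : 'I_n) (ab : b = a.+1 :> nat) : diagram n :=
  Diagram (gen_link_planar ab).

(* Stacking D2 on top of D1: the vertices of the stack are the outer vertices *)
(* (inl) and the middle ones (inr), where the top line of D1 and the bottom   *)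
(* line of D2 are glued together.                                             *)
Definition lower_vertex n (v : vertex n) : vertex n + 'I_n :=
  if v.1 then inr v.2 else inl v.
Definition upper_vertex n (v : vertex n) : vertex n + 'I_n :=
  if v.1 then inl v else inr v.2.

Definition stack n (D2 D1 : diagram n) : rel (vertex n + 'I_n) :=
  fun x y =>
    [exists v, (x == lower_vertex v) && (y == lower_vertex (D1 v))]
    || [exists v, (x == upper_vertex v) && (y == upper_vertex (D2 v))].

(* D is the diagram obtained from the stack by deleting its closed loops      *)
Definition stack_diagram n (D2 D1 D : diagram n) : bool :=
  [forall u, forall v,
    (D u == v) == (u != v) && connect (stack D2 D1) (inl u) (inl v)].

(* a closed loop is a connected component without outer vertices              *)
Definition loops n (D2 D1 : diagram n) : nat :=
  n_comp (stack D2 D1)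
    [pred x | [forall v, ~~ connect (stack D2 D1) x (inl v)]].

(* The rest only uses the field structure of K, its element q and its bar map *)
(* (instantiated with groundField R, q R and bar R).                          *)
Section TemperleyLieb.
Variables (K : fieldType) (q : K) (bar : K -> K).

Definition TL n : Type := {ffun diagram n -> K^o}.
HB.instance Definition _ n := Vector.on (TL n).

Definition dg n (D : diagram n) : TL n := [ffun D' => (D' == D)%:R].

Definition TL_one n : TL n := dg (id_diagram n).

Definition TL_mul n (x y : TL n) : TL n :=
  \sum_(D2 : diagram n) \sum_(D1 : diagram n)
    \sum_(D : diagram n | stack_diagram D2 D1 D)
      (x D2 * y D1 * (- q - q^-1) ^+ loops D2 D1) *: dg D.

Definition V : Type := {ffun bool -> K^o}.
HB.instance Definition _ := Vector.on V.

Definition vec (s : bool) : V := [ffun t => (t == s)%:R].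

(* The n-th tensor power of V, with basis the tensor products of the v_s;     *)
(* entry j of a word is the sign of the tensor component with number j, so    *)
(* words are read from right to left.                                         *)
Definition Vt n : Type := {ffun n.-tuple bool -> K^o}.
HB.instance Definition _ n := Vector.on (Vt n).

Definition vecs n (w : n.-tuple bool) : Vt n := [ffun u => (u == w)%:R].

Definition tensv n (y : 'I_n -> V) : Vt n :=
  [ffun w : n.-tuple bool => \prod_j y j (tnth w j)].

(* x (x) y in Vt n.+1 = Vt n (x) V *)
Definition tensr n (x : Vt n) (y : V) : Vt n.+1 :=
  [ffun w : n.+1.-tuple bool => x [tuple of behead w] * y (thead w)].

(* the x_s such that x = x_+ (x) v_+ + x_- (x) v_- *)
Definition component n (x : Vt n.+1) (s : bool) : Vt n :=
  [ffun w : n.-tuple bool => x [tuple of s :: w]].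

Definition tens_op n (A : 'I_n -> V -> V) (x : Vt n) : Vt n :=
  \sum_(w : n.-tuple bool) x w *: tensv (fun j => A j (vec (tnth w j))).

(* epsilon (v_l (x) v_r), and the coefficient of v_l (x) v_r in delta 1       *)
Definition eps (l r : bool) : K :=
  match l, r with true, false => - q | false, true => 1 | _, _ => 0 end.
Definition delta (l r : bool) : K :=
  match l, r with true, false => 1 | false, true => - q^-1 | _, _ => 0 end.

Definition replace2 n (w : n.-tuple bool) (a b : 'I_n) (l r : bool) :
    n.-tuple bool :=
  [tuple if j == b then l else if j == a then r else tnth w j | j < n].

(* delta \o epsilon on the adjacent components b (left) and a (right)         *)
Definition gen_act n (a b : 'I_n) (x : Vt n) : Vt n :=
  \sum_(w : n.-tuple bool) x w *: (eps (tnth w b) (tnth w a) *: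
    \sum_(l : bool) \sum_(r : bool) delta l r *: vecs (replace2 w a b l r)).

Definition is_TL_action n (rho : {linear TL n -> 'End(Vt n)}) : Prop :=
  [/\ rho (TL_one n) = \1%VF,
      forall x y, rho (TL_mul x y) = (rho x \o rho y)%VF &
      forall (a b : 'I_n) (ab : b = a.+1 :> nat) (x : Vt n),
        rho (dg (gen_diagram ab)) x = gen_act a b x].

(* v_-^(x)k (x) v_+^(x)(n-k) *)
Definition vmp n k : Vt n := vecs [tuple (j < n - k)%N | j < n].

Definition leftmost n k (j : 'I_n) : bool := (n - k <= j)%N.

(* D (x) 1 is a basis element of the induced module: no bottom link of D joins *)
(* two of the k leftmost or two of the n - k rightmost vertices.              *)
Definition diagrammatic_basis n k (D : diagram n) : Prop :=
  forall i j : 'I_n, D (false, i) = (false, j) ->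
    ~~ (leftmost k i && leftmost k j) /\ ~~ (~~ leftmost k i && ~~ leftmost k j).

(* The image of g (x) 1 under the embedding of the induced module.            *)
Definition ind_embedding n (rho : {linear TL n -> 'End(Vt n)}) k (g : TL n) :
  Vt n := rho g (vmp n k).

Definition opK (y : V) : V := (q * y true) *: vec true + (q^-1 * y false) *: vec false.
Definition opE (y : V) : V := y false *: vec true.
Definition opF (y : V) : V := y true *: vec false.

(* the components with number r < j are those to the right of component j     *)
Definition opFt n (x : Vt n) : Vt n :=
  \sum_(j < n) tens_op
    (fun r => if r == j then opF else if (r < j)%N then opK else id) x.

(* The recursion starts at the 0-th tensor power K, where psi is bar; as      *)
(* F = 0 there, it gives psi v_+ = v_+ and psi v_- = v_- in Vt 1.             *)
Fixpoint psi n : Vt n -> Vt n :=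
  match n with
  | 0 => fun x => [ffun w => bar (x w)]
  | n'.+1 => fun x => \sum_(s : bool)
      (tensr (psi (component x s)) (vec s) +
       (q - q^-1) *: tensr (opFt (psi (component x s))) (opE (vec s)))
  end.

Definition in_qVZqV (a : K) : Prop :=
  exists p : {poly int}, a = q^-1 * (map_poly intr p).[q^-1].

Definition psum n (w : n.-tuple bool) (m : nat) : int :=
  \sum_(i < n | (i < m)%N) (if tnth w i then 1 else -1).

Definition dual_canonical n (w : n.-tuple bool) (x : Vt n) : Prop :=
  psi x = x /\
  forall u : n.-tuple bool,
    in_qVZqV ((x - vecs w) u) /\
    ((x - vecs w) u != 0 ->
       psum u n = psum w n /\
       forall m, (1 <= m <= n)%N -> psum w m <= psum u m).

Definition top_links n (D : diagram n) : {set {set 'I_n}} :=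
  [set [set p.1; p.2] | p : 'I_n * 'I_n & D (true, p.1) == (true, p.2)].

Definition transversals n (D : diagram n) : {set {set 'I_n}} :=
  [set S : {set 'I_n} | (#|S| == #|top_links D|) &&
                        [forall C in top_links D, #|S :&: C| == 1%N]].

Definition is_min n (i : 'I_n) (C : {set 'I_n}) : bool :=
  (i \in C) && [forall j in C, (i <= j)%N].

Definition sgnT n (D : diagram n) (S : {set 'I_n}) : K :=
  (- q^-1) ^+ #|[set C in top_links D |
                  [exists i, is_min i C && (S :&: C == [set i])]]|.

(* A top vertex j linked to the bottom gets v_- iff its link ends in one of    *)
(* the k leftmost bottom vertices; the other components are read off from I.  *)
Definition vT n k (D : diagram n) (I : {set 'I_n}) : Vt n :=
  vecs [tuple (let v := D (true, j) in
               if v.1 then j \in I else ~~ leftmost k v.2) | j < n].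

End TemperleyLieb.

(* Main.v *)
Require Import Defs.
From HB Require Import structures.
From mathcomp Require Import all_boot all_order all_algebra.
From mathcomp Require Import reals complex.
From mathcomp Require Import ring zify.

Set Implicit Arguments.
Unset Strict Implicit.
Unset Printing Implicit Defensive.

Import GRing.Theory Num.Theory.
Local Open Scope ring_scope.

(** Read the boundary of the strip as a line that starts at the wall between
    the two groups of bottom vertices: the k left bottom vertices going away from
    the wall, the top line from left to right, and the n-k right bottom vertices
    going back to the wall.  Each link then has an opening and a closing end, so a
    diagram is a well-formed word of parentheses.  D (x) 1 lies in the diagrammatic
    basis exactly when the left bottom vertices open and the right ones close, and
    such a D is determined by the word w that records which top vertices open
    ([oriented_top_word_inj]).

    A word w' with - + at two adjacent positions, + to the right, and the word w in
    which these signs are exchanged belong to diagrams D' and D with D = e D', where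
    e is the generator at these positions; no loop arises.  Topologically, the two
    links of D' that end at these vertices are joined to one, and a cup is created
    ([surgery], [TL_mul_gen]).  All words are reached in this way from
    - ... - + ... +, whose diagram is the identity ([word_ind]), so the vector of D
    is computed by applying generators to v_- ... v_- v_+ ... v_+
    ([word_realised]).

    Let the left bottom vertices carry + and the right ones -, and give each link
    the entry of delta at the signs of its opening and closing ends.  The product
    of these entries, as a function of the word of signs on the top line, is a
    vector [diagram_vec].  A generator contracts delta, eps and delta to a single
    delta (the zigzag identity), hence maps the vector of D' to the vector of D
    ([gen_act_diagram_vec]).  The nonzero coefficients of this vector are indexed
    by the transversals of the top links, which gives the formula
    ([diagram_vec_transversals]).

    The vector is fixed by the bar involution, because this involution commutes
    with the generators ([psi_gen_act]) and fixes the initial vector ([psi_vmp]).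
    Its coefficient is 1 at w and a positive power of -q^-1 at every other word of
    its support; such a word arises from w by exchanging the two signs of some
    cups, which can only increase the partial sums from the right
    ([diagram_vec_triangular]).  So the vector of D is the dual canonical basis
    element with leading word w. *)

(** * Rightmost components, the operator F and the bar involution *)

Section Tensor.
Variables (K : fieldType) (q : K).
Hypothesis q0 : q != 0.
Implicit Types n : nat.

Lemma component_inj n (x y : Vt K n.+1) :
  (forall s, component x s = component y s) -> x = y.
Proof.
move=> h; apply/ffunP=> w; case/tupleP: w => s w.
by have /ffunP/(_ w) := h s; rewrite !ffunE.
Qed.

Lemma componentD n (x y : Vt K n.+1) s :
  component (x + y) s = component x s + component y s.
Proof. by apply/ffunP=> w; rewrite !ffunE. Qed.

Lemma componentZ n c (x : Vt K n.+1) s : component (c *: x) s = c *: component x s.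
Proof. by apply/ffunP=> w; rewrite !ffunE. Qed.

Lemma component_tensr n (x : Vt K n) y s : component (tensr x y) s = y s *: x.
Proof.
apply/ffunP=> w; rewrite !ffunE theadE mulrC; congr (_ * x _).
by apply: val_inj.
Qed.

Lemma component_sum n (I : finType) (F : I -> Vt K n.+1) s :
  component (\sum_i F i) s = \sum_i component (F i) s.
Proof.
by apply/ffunP=> w; rewrite !(ffunE, sum_ffunE); apply: eq_bigr => i _; rewrite ffunE.
Qed.

Lemma big_tuple_cons n (F : n.+1.-tuple bool -> K) :
  \sum_w F w = \sum_(t : bool) \sum_(w : n.-tuple bool) F [tuple of t :: w].
Proof.
rewrite pair_big /= (reindex (fun p : bool * n.-tuple bool => [tuple of p.1 :: p.2])) //=.
exists (fun w => (thead w, [tuple of behead w])) => [[t w] _|w _] /=.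
  by rewrite theadE; congr pair; apply: val_inj.
by rewrite -tuple_eta.
Qed.

Lemma tens_opE n A (x : Vt K n) u :
  tens_op A x u = \sum_w x w * \prod_j A j (vec K (tnth w j)) (tnth u j).
Proof. by rewrite /tens_op sum_ffunE; apply: eq_bigr => w _; rewrite !ffunE. Qed.

Lemma component_tens_op n A (x : Vt K n.+1) s :
  component (tens_op A x) s =
  \sum_t A ord0 (vec K t) s *: tens_op (fun j => A (lift ord0 j)) (component x t).
Proof.
apply/ffunP=> u; rewrite ffunE tens_opE sum_ffunE big_tuple_cons.
apply: eq_bigr => t _; rewrite ffunE tens_opE /GRing.scale /= mulr_sumr; apply: eq_bigr => w _.
rewrite ffunE big_ord_recl !tnth0 mulrCA; congr (_ * _); congr (_ * _).
by apply: eq_bigr => j _; rewrite !tnthS.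
Qed.

Lemma tens_op_id n (x : Vt K n) : tens_op (fun=> id) x = x.
Proof.
apply/ffunP=> u; rewrite tens_opE (bigD1 u) //= [X in _ + X]big1 ?addr0 => [|w wu].
  by rewrite big1 ?mulr1 // => j _; rewrite ffunE eqxx.
have [j /eqP jn] : exists j, tnth w j != tnth u j.
  apply/existsP; rewrite -negb_forall; apply: contra wu => /forallP h.
  by apply/eqP/eq_from_tnth => j; apply/eqP.
by rewrite (bigD1 j) //= ffunE eq_sym (introF eqP jn) mul0r mulr0.
Qed.

Lemma eq_tens_op n A B (x : Vt K n) :
  (forall j y, A j y = B j y) -> tens_op A x = tens_op B x.
Proof.
move=> h; apply/ffunP=> u; rewrite !tens_opE; apply: eq_bigr => w _.
by congr (_ * _); apply: eq_bigr => j _; rewrite h.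
Qed.

(** The coproduct rule F (y (x) v) = F y (x) K v + y (x) F v, split according to
    the sign of the rightmost component. *)
Lemma opFt_component n (x : Vt K n.+1) s :
  component (opFt q x) s =
  if s then q *: opFt q (component x true)
  else q^-1 *: opFt q (component x false) + component x true.
Proof.
rewrite /opFt component_sum big_ord_recl component_tens_op /=.
rewrite [X in X + _](_ : _ = if s then 0 else component x true); last first.
  under eq_bigr => t _ do rewrite tens_op_id.
  by apply/ffunP=> u; rewrite big_bool; case: s; rewrite !ffunE /= /GRing.scale /=; ring.
rewrite addrC; transitivity ((if s then q else q^-1) *: \sum_(j < n) tens_op (fun r =>
   if r == j then @opF K else if (r < j)%N then opK q else id) (component x s)
   + if s then 0 else component x true); last by case: s; rewrite ?addr0.
congr (_ + _); rewrite scaler_sumr; apply: eq_bigr => j _.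
rewrite component_tens_op big_bool /=.
under eq_tens_op => r y do rewrite (inj_eq (@lift_inj _ ord0)) ltnS.
under [in X in _ + X]eq_tens_op => r y do rewrite (inj_eq (@lift_inj _ ord0)) ltnS.
by apply/ffunP=> u; case: s; rewrite !ffunE /= /GRing.scale /=; ring.
Qed.

Lemma tnth_replace2 n (w : n.-tuple bool) a b l r j :
  tnth (replace2 w a b l r) j = if j == b then l else if j == a then r else tnth w j.
Proof. by rewrite tnth_mktuple. Qed.

(** The transpose of the definition: delta only sees the entries of u at a and b,
    and the words that contribute to the coefficient at u agree with u elsewhere. *)
Lemma gen_actE n (a b : 'I_n) (x : Vt K n) u : a != b ->
  gen_act q a b x u = delta q (tnth u b) (tnth u a) *
    \sum_(l : bool) \sum_(r : bool) eps q l r * x (replace2 u a b l r).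
Proof.
move=> ab; rewrite /gen_act sum_ffunE.
have inner w : (\sum_(l : bool) \sum_(r : bool)
     delta q l r *: vecs K (replace2 w a b l r)) u
   = (u == replace2 w a b (tnth u b) (tnth u a))%:R * delta q (tnth u b) (tnth u a).
  have nu l r : (u == replace2 w a b l r) =
      [&& l == tnth u b, r == tnth u a & u == replace2 w a b (tnth u b) (tnth u a)].
    case: (eqVneq l (tnth u b)) => [->|lb]; last first.
      by apply: contraNF lb => /eqP->; rewrite tnth_replace2 eqxx.
    case: (eqVneq r (tnth u a)) => [->//|ra].
    by apply: contraNF ra => /eqP->; rewrite tnth_replace2 eqxx (negbTE ab).
  rewrite !(big_bool, ffunE) /= /GRing.scale /=.
  rewrite (nu true true) (nu true false) (nu false true) (nu false false).
  by case: (tnth u b) (tnth u a) => [] [] /=; ring.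
transitivity (\sum_(w | u == replace2 w a b (tnth u b) (tnth u a))
   delta q (tnth u b) (tnth u a) * (eps q (tnth w b) (tnth w a) * x w)).
  rewrite [RHS]big_mkcond; apply: eq_bigr => w _.
  rewrite ffunE [X in _ *: X]ffunE inner /GRing.scale /=.
  by case: ifP => _; rewrite ?mul1r ?mul0r ?mulr0 // mulrCA mulrA mulrC mulrA.
rewrite -mulr_sumr; congr (_ * _); rewrite pair_big /=.
rewrite (reindex (fun p : bool * bool => replace2 u a b p.1 p.2)) /=; last first.
  exists (fun w => (tnth w b, tnth w a)) => [[l r] _|w] /=.
    by rewrite !tnth_replace2 !eqxx (negbTE ab).
  rewrite inE => /eqP e; apply: eq_from_tnth => j; rewrite tnth_replace2.
  case: eqVneq => [->//|jb]; case: eqVneq => [->//|ja].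
  by rewrite e tnth_replace2 (negbTE jb) (negbTE ja).
apply: eq_big => [[l r]|[l r] _] /=.
  apply/eqP/eq_from_tnth => j; rewrite !tnth_replace2.
  by case: eqVneq => [->//|jb]; case: eqVneq => [->//|ja].
by rewrite !tnth_replace2 !eqxx (negbTE ab).
Qed.

Lemma tnth_cons n s (w : n.-tuple bool) j :
  tnth [tuple of s :: w] j = if unlift ord0 j is Some i then tnth w i else s.
Proof. by case: unliftP => [i|] ->; rewrite ?tnth0 ?tnthS. Qed.

Lemma gen_act_component n (a b : 'I_n) (x : Vt K n.+1) s : a != b ->
  component (gen_act q (lift ord0 a) (lift ord0 b) x) s =
  gen_act q a b (component x s).
Proof.
move=> ab; apply/ffunP=> u; rewrite ffunE !gen_actE ?(inj_eq (@lift_inj _ ord0)) //.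
rewrite !tnthS; congr (_ * _); apply: eq_bigr => l _; apply: eq_bigr => r _.
rewrite ffunE; congr (_ * x _); apply: eq_from_tnth => j.
rewrite !(tnth_replace2, tnth_cons); case: unliftP => [i|] -> //=.
by rewrite !(inj_eq (@lift_inj _ ord0)) tnth_replace2.
Qed.

(** This is id (x) eps, eps acting on the two rightmost components. *)
Definition contract n (x : Vt K n.+2) : Vt K n :=
  - q *: component (component x false) true + component (component x true) false.

Lemma gen_act0_component n (x : Vt K n.+2) s t :
  component (component (gen_act q ord0 (lift ord0 ord0) x) s) t =
  delta q t s *: contract x.
Proof.
apply/ffunP=> u.
have rep l r : replace2 [tuple of s :: [tuple of t :: u]] ord0 (lift ord0 ord0) l r
             = [tuple of r :: [tuple of l :: u]].
  apply: eq_from_tnth => j; rewrite tnth_replace2 !tnth_cons.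
  case: unliftP => [i|] -> //=.
  by rewrite (inj_eq (@lift_inj _ ord0)) !tnth_cons; case: unliftP => [i'|] ->.
rewrite !ffunE gen_actE // !(tnth_cons, unlift_none, liftK) /=.
rewrite /GRing.scale /=; congr (_ * _).
rewrite !big_bool /= !(mul0r, add0r, addr0, mul1r).
by rewrite !rep.
Qed.

Lemma opFtD n (x y : Vt K n) : opFt q (x + y) = opFt q x + opFt q y.
Proof.
rewrite /opFt -big_split; apply: eq_bigr => j _; rewrite /tens_op -big_split /=.
by apply: eq_bigr => w _; rewrite ffunE scalerDl.
Qed.

Lemma opFtZ n c (x : Vt K n) : opFt q (c *: x) = c *: opFt q x.
Proof.
rewrite /opFt scaler_sumr; apply: eq_bigr => j _; rewrite /tens_op scaler_sumr.
by apply: eq_bigr => w _; rewrite ffunE scalerA.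
Qed.

Lemma gen_actD n (a b : 'I_n) (x y : Vt K n) :
  gen_act q a b (x + y) = gen_act q a b x + gen_act q a b y.
Proof.
by rewrite /gen_act -big_split; apply: eq_bigr => w _; rewrite ffunE scalerDl.
Qed.

Lemma gen_actZ n (a b : 'I_n) c (x : Vt K n) :
  gen_act q a b (c *: x) = c *: gen_act q a b x.
Proof.
by rewrite /gen_act scaler_sumr; apply: eq_bigr => w _; rewrite ffunE [RHS]scalerA.
Qed.

Lemma component2_inj n (x y : Vt K n.+2) :
  (forall s t, component (component x s) t = component (component y s) t) -> x = y.
Proof. by move=> h; apply: component_inj => s; apply: component_inj. Qed.

(** Adjacent positions are shifts of the positions 0 and 1; this reduces statements
    about generators to the rightmost pair, by removing components from the right. *)
Lemma gen_pair_ind (P : forall n, 'I_n -> 'I_n -> Prop) :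
  (forall n, P n.+2 ord0 (lift ord0 ord0)) ->
  (forall n (a b : 'I_n), b = a.+1 :> nat -> P n a b ->
     P n.+1 (lift ord0 a) (lift ord0 b)) ->
  forall n (a b : 'I_n), b = a.+1 :> nat -> P n a b.
Proof.
move=> P0 PS; elim=> [[]//|n IH] a b ab.
case: (unliftP ord0 a) ab => [a'|] -> ab; case: (unliftP ord0 b) ab => [b'|] -> //= ab.
  by apply: PS; last apply: IH; case: ab.
case: n {a b IH PS} (P0 n.-1) b' ab => [? []//|n] /= h b' ab.
by rewrite (_ : b' = ord0) //; apply: val_inj; case: ab.
Qed.

Ltac pointwise := let u := fresh "u" in
  apply/ffunP=> u; rewrite !ffunE /GRing.scale /=.

(** eps and delta are morphisms of modules: F annihilates delta 1, eps annihilates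
    the image of F on V (x) V, and K (x) K fixes delta 1 and preserves eps. *)
Lemma opFt_gen_act n (a b : 'I_n) (x : Vt K n) : b = a.+1 :> nat ->
  opFt q (gen_act q a b x) = gen_act q a b (opFt q x).
Proof.
move=> ab; move: n a b ab x; apply: gen_pair_ind => [n|n a b ab IH] x.
  apply: component2_inj => s t; rewrite gen_act0_component.
  have E : contract (opFt q x) = opFt q (contract x).
    rewrite /contract !opFt_component !(componentD, componentZ) !opFt_component.
    rewrite !(opFtD, opFtZ); pointwise; field.
    done.
  rewrite E; case: s; case: t; rewrite !(opFt_component, componentD, componentZ);
    rewrite !gen_act0_component /= ?opFtZ; pointwise; field; done.
have ba : a != b by rewrite -val_eqE /= ab; lia.
apply: component_inj => s; rewrite opFt_component !gen_act_component // opFt_component.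
by case: s; rewrite ?(gen_actD, gen_actZ) IH.
Qed.

Section Psi.
Variable bar : {rmorphism K -> K}.
Hypothesis barq : bar q = q^-1.

Lemma psi_component n (x : Vt K n.+1) s :
  component (psi q bar x) s =
  if s then psi q bar (component x true)
            + (q - q^-1) *: opFt q (psi q bar (component x false))
  else psi q bar (component x false).
Proof.
rewrite /= big_bool /= !(componentD, componentZ, component_tensr) !ffunE /=.
by case: s; pointwise; ring.
Qed.

Lemma psiD n (x y : Vt K n) : psi q bar (x + y) = psi q bar x + psi q bar y.
Proof.
elim: n x y => [|n IH] x y; first by apply/ffunP=> u; rewrite !ffunE rmorphD.
apply: component_inj => -[]; rewrite !(componentD, psi_component) !IH //.
by rewrite opFtD; pointwise; ring.
Qed.

Lemma psiZ n c (x : Vt K n) : psi q bar (c *: x) = bar c *: psi q bar x.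
Proof.
elim: n x => [|n IH] x.
  by apply/ffunP=> u; rewrite !ffunE /GRing.scale /= ?rmorphM.
apply: component_inj => -[]; rewrite !(componentZ, psi_component) !IH //.
by rewrite opFtZ; pointwise; ring.
Qed.

(** The coefficients of eps and delta are not bar invariant, but the correction
    term (q - q^-1) F (x) E compensates for this: on eps it contributes
    -q + (q - q^-1) = -q^-1, the conjugate of -q, and similarly on delta.  The terms
    in which F reaches the components further left cancel. *)
Lemma psi_gen_act n (a b : 'I_n) (x : Vt K n) : b = a.+1 :> nat ->
  psi q bar (gen_act q a b x) = gen_act q a b (psi q bar x).
Proof.
move=> ab; move: n a b ab x; apply: gen_pair_ind => [n|n a b ab IH] x.
  apply: component2_inj => s t; rewrite gen_act0_component.
  have E : contract (psi q bar x) = psi q bar (contract x).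
    rewrite /contract !psi_component !(componentD, componentZ) !(psi_component, opFt_component).
    rewrite !(opFtD, opFtZ, psiD, psiZ, rmorphN) barq; pointwise; field.
    done.
  rewrite E; case: s; case: t;
    rewrite !(psi_component, opFt_component, componentD, componentZ);
    rewrite !gen_act0_component /= ?(opFtD, opFtZ, psiD, psiZ) ?rmorphN ?fmorphV
       ?rmorph0 ?rmorph1 ?barq; pointwise; field; rewrite ?q0 ?oner_neq0 //.
have ba : a != b by rewrite -val_eqE /= ab; lia.
apply: component_inj => s; rewrite psi_component !gen_act_component // psi_component.
by case: s; rewrite ?(gen_actD, gen_actZ) !IH // opFt_gen_act.
Qed.

Lemma opFt0 n : opFt q (0 : Vt K n) = 0.
Proof. by rewrite -[0 in LHS](scale0r (0 : Vt K n)) opFtZ scale0r. Qed.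

Lemma psi0 n : psi q bar (0 : Vt K n) = 0.
Proof. by rewrite -[0 in LHS](scale0r (0 : Vt K n)) psiZ rmorph0 scale0r. Qed.

Lemma vmp_component n k s : (k <= n.+1)%N ->
  component (vmp K n.+1 k) s =
  if s == (k <= n)%N then vmp K n (minn k n) else 0.
Proof.
move=> kn; apply/ffunP=> u; rewrite !ffunE.
have eqc : ([tuple of s :: u] == [tuple (j < n.+1 - k)%N | j < n.+1]) =
           (s == (k <= n)%N) && (u == [tuple (j < n - minn k n)%N | j < n]).
  apply/eqP/andP => [e|[/eqP es /eqP eu]].
    split; apply/eqP.
      by have := congr1 (fun w => tnth w ord0) e; rewrite tnth0 tnth_mktuple /=; lia.
    apply: eq_from_tnth => j; have := congr1 (fun w => tnth w (lift ord0 j)) e.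
    by rewrite /= tnthS !tnth_mktuple /= /bump /=; have := ltn_ord j; lia.
  apply: eq_from_tnth => j; rewrite tnth_cons tnth_mktuple.
  case: unliftP => [i|] -> /=; first rewrite eu tnth_mktuple /bump /=; last by lia.
  by have := ltn_ord i; lia.
by rewrite eqc; case: (s == _); rewrite ffunE.
Qed.

Lemma opFt_minus n : opFt q (vmp K n n) = 0.
Proof.
elim: n => [|n IH]; first by rewrite /opFt big_ord0.
apply: component_inj => s; rewrite opFt_component !vmp_component //
  ?ltnn /= ?(minn_idPr (leqnSn n)).
by apply/ffunP=> u; case: s; rewrite ?opFt0 ?IH ?scaler0 ?addr0 !ffunE ?addr0.
Qed.

(** E kills v_+ and F kills v_- (x) ... (x) v_-, so the correction term of psi is
    zero at every step of the recursion. *)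
Lemma psi_vmp n k : (k <= n)%N -> psi q bar (vmp K n k) = vmp K n k.
Proof.
elim: n k => [|n IH] k kn.
  by apply/ffunP=> u; rewrite !ffunE; case: (_ == _); rewrite ?rmorph0 ?rmorph1.
apply: component_inj => s; rewrite psi_component !vmp_component //.
case: (leqP k n) => /= kn'.
  by case: s; rewrite ?IH ?psi0 ?opFt0 ?scaler0 ?addr0.
by case: s; rewrite ?IH ?psi0 ?opFt_minus ?scaler0 ?addr0.
Qed.
End Psi.
End Tensor.

(** * Surgery on non-crossing matchings *)

Section Diagram.
Variable n : nat.
Implicit Types (D : diagram n) (u v : vertex n).

Lemma diagram_inv D v : D (D v) = v.
Proof. by case/and3P: (linkP D) => /forallP/(_ v)/eqP. Qed.

Lemma diagram_fp D v : D v != v.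
Proof. by case/and3P: (linkP D) => _ /forallP/(_ v). Qed.

Lemma diagram_inj D : injective D.
Proof. exact: can_inj (diagram_inv D). Qed.

Lemma diagram_eqC D u v : (D u == v) = (u == D v).
Proof. by rewrite -{2}(diagram_inv D u) (inj_eq (@diagram_inj D)). Qed.

Lemma diagram_noncrossing D u v :
  ~ (bpos u < bpos v < bpos (D u) /\ bpos (D u) < bpos (D v))%N.
Proof.
case/and3P: (linkP D) => _ _ /forallP/(_ u)/forallP/(_ v)/negP h [/andP[h1 h2] h3].
by apply: h; rewrite h1 h2 h3.
Qed.

Lemma bpos_inj : injective (@bpos n).
Proof.
move=> [[] [i hi]] [[] [j hj]]; rewrite /bpos /= => e; congr (_, _);
 try (apply: val_inj => /=); lia.
Qed.

Lemma bpos_neq u v : u != v -> bpos u != bpos v.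
Proof. by apply: contra_neq => /bpos_inj. Qed.

(** For z different from x and y this says that z lies between them, in either
    order of x and y; the exclusive or makes it additive under concatenation of
    arcs. *)
Definition between (x y z : nat) := (x < z)%N (+) (y < z)%N.

(** No vertex separates the neighbours a and b, so the arc from x to y has the same
    sides as the concatenation of the arcs from x to b and from a to y. *)
Lemma between_surgery (a b x y v w : nat) : a = b.+1 ->
  v != a -> w != a ->
  between b x v = between b x w -> between a y v = between a y w ->
  between x y v = between x y w.
Proof.
rewrite /between => -> va wa.
have E z : z != b.+1 -> (b < z)%N = (b.+1 < z)%N.
  by rewrite eq_sym => h; rewrite [RHS]ltn_neqAle h.
rewrite !E //.
by do 6!case: (_ < _)%N.
Qed.

(** The symmetric form of planarity: a link does not separate the two ends of
    another link. *)
Lemma diagram_between D u v : v != u -> v != D u ->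
  between (bpos u) (bpos (D u)) (bpos v) = between (bpos u) (bpos (D u)) (bpos (D v)).
Proof.
move=> vu vDu.
have inj := bpos_neq.
have := inj _ _ vu; have := inj _ _ vDu; have := inj _ _ (diagram_fp D u).
have : D v != D u by rewrite (inj_eq (@diagram_inj D)).
have : D v != u by apply: contraNneq vDu => <-; rewrite diagram_inv.
move=> /inj h1 /inj h2 h3 h4 h5.
have n1 := @diagram_noncrossing D u v; have n2 := @diagram_noncrossing D u (D v).
have n3 := @diagram_noncrossing D (D u) v; have n4 := @diagram_noncrossing D (D u) (D v).
have n5 := @diagram_noncrossing D v u; have n6 := @diagram_noncrossing D v (D u).
have n7 := @diagram_noncrossing D (D v) u; have n8 := @diagram_noncrossing D (D v) (D u).
rewrite !diagram_inv in n1 n2 n3 n4 n5 n6 n7 n8; rewrite /between; lia.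
Qed.

Section Surgery.
Variables (D : diagram n) (a b : 'I_n).
Hypotheses (ab : b = a.+1 :> nat) (Dab : D (true, a) != (true, b)).
Let X := D (true, b).
Let Y := D (true, a).

(** The matching obtained by stacking the generator at a and b on top of D: the
    cap of the generator joins the two links of D that end at a and b, and its cup
    joins a to b. *)
Definition surgery_link : {ffun vertex n -> vertex n} :=
  [ffun v => if v == (true, a) then (true, b) else if v == (true, b) then (true, a)
             else if v == X then Y else if v == Y then X else D v].

(** The new link from X to Y runs along the old links from X to b and from a to Y,
    which are not separated from each other since a and b are neighbours. *)
Lemma surgery_planar : planar surgery_link.
Proof.
have abn : (true, a) != (true, b) :> vertex n by rewrite xpair_eqE /= -val_eqE /= ab; lia.
have XY : X != Y by rewrite (inj_eq (@diagram_inj D)) eq_sym.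
have YX : Y != X by rewrite eq_sym.
have Xa : X != (true, a).
  by apply: contraNneq Dab => e; rewrite -e diagram_inv.
have Xb : X != (true, b) by apply: diagram_fp.
have Ya : Y != (true, a) by apply: diagram_fp.
have DX : D X = (true, b) by apply: diagram_inv.
have DY : D Y = (true, a) by apply: diagram_inv.
apply/and3P; split.
- have abn' : (true, b) != (true, a) :> vertex n by rewrite eq_sym.
  apply/forallP=> v; rewrite !ffunE.
  case: (eqVneq v (true, a)) => [->|va].
    by rewrite (negbTE abn') eqxx.
  case: (eqVneq v (true, b)) => [->|vb]; first by rewrite eqxx.
  case: (eqVneq v X) => [->|vX].
    by rewrite (negbTE Ya) (negbTE Dab) (negbTE YX) eqxx.
  case: (eqVneq v Y) => [->|vY].
    by rewrite (negbTE Xa) (negbTE Xb) eqxx.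
  by rewrite !diagram_eqC -/X -/Y DX DY (negbTE va) (negbTE vb) (negbTE vX) (negbTE vY) diagram_inv.
- apply/forallP=> v; rewrite !ffunE.
  case: (eqVneq v (true, a)) => [->|va]; first by rewrite eq_sym.
  case: (eqVneq v (true, b)) => [->|vb] //.
  case: (eqVneq v X) => [->|vX]; first by rewrite eq_sym.
  case: (eqVneq v Y) => [->|vY] //; exact: diagram_fp.
have pab : bpos ((true, a) : vertex n) = (bpos ((true, b) : vertex n)).+1.
  by rewrite /bpos /=; have := ltn_ord b; lia.
have inj := bpos_neq.
apply/forallP=> u; apply/forallP=> v; apply/negP => /and3P[].
rewrite !ffunE.
have abp := inj _ _ abn.
have pXb := inj _ _ Xb; have pXa := inj _ _ Xa; have pYa := inj _ _ Ya.
have pYb : bpos Y != bpos ((true, b) : vertex n) by apply: inj.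
have pXY := inj _ _ XY.
(* The links of D that are cut do not separate the ends of any other link. *)
have sepX w : w != (true, b) -> w != X ->
    between (bpos ((true, b) : vertex n)) (bpos X) (bpos w) =
    between (bpos ((true, b) : vertex n)) (bpos X) (bpos (D w)).
  by move=> w1 w2; apply: diagram_between.
have sepY w : w != (true, a) -> w != Y ->
    between (bpos ((true, a) : vertex n)) (bpos Y) (bpos w) =
    between (bpos ((true, a) : vertex n)) (bpos Y) (bpos (D w)).
  by move=> w1 w2; apply: diagram_between.
have gen w : w != (true, a) -> w != (true, b) -> w != X -> w != Y ->
   [/\ bpos w != bpos ((true, a) : vertex n), bpos w != bpos ((true, b) : vertex n),
       bpos w != bpos X & bpos w != bpos Y] /\
   [/\ bpos (D w) != bpos ((true, a) : vertex n), bpos (D w) != bpos ((true, b) : vertex n),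
       bpos (D w) != bpos X & bpos (D w) != bpos Y].
  by move=> wa wb wX wY; split; split; apply: inj => //; rewrite diagram_eqC // ?DX ?DY.
have sepXY w : w != (true, a) -> w != (true, b) -> w != X -> w != Y ->
    between (bpos X) (bpos Y) (bpos w) = between (bpos X) (bpos Y) (bpos (D w)).
  move=> wa wb wX wY; have [[h1 _ _ _] [h2 _ _ _]] := gen w wa wb wX wY.
  exact: between_surgery pab h1 h2 (sepX w wb wX) (sepY w wa wY).
have nc := @diagram_noncrossing D u v.
rewrite /between in sepXY; clear sepX sepY.
case: (eqVneq u (true, a)) => [->|ua]; [|case: (eqVneq u (true, b)) => [->|ub];
  [|case: (eqVneq u X) => [->|uX]; [|case: (eqVneq u Y) => [->|uY]]]];
(case: (eqVneq v (true, a)) => [->|va]; [|case: (eqVneq v (true, b)) => [->|vb];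
  [|case: (eqVneq v X) => [->|vX]; [|case: (eqVneq v Y) => [->|vY]]]]);
rewrite /=; try (clear - pab pXb pXa pYa pYb pXY nc; lia).
all: try (have [[? ? ? ?] [? ? ? ?]] := gen _ ua ub uX uY; have := sepXY _ ua ub uX uY;
  clear sepXY gen).
all: try (have [[? ? ? ?] [? ? ? ?]] := gen _ va vb vX vY; have := sepXY _ va vb vX vY;
  clear sepXY gen).
(* In the remaining cases one of u and v is X or Y, and the link of the other one
   is the same as in D. *)
all: by clear; do 4!case: ltngtP => ? //=; lia.
Qed.
End Surgery.
End Diagram.

(** * Multiplying a diagram by a generator *)

Section Stack.
Variables (n : nat) (D : diagram n) (a b : 'I_n).
Hypotheses (ab : b = a.+1 :> nat) (Dab : D (true, a) != (true, b)).
Implicit Types (u v : vertex n).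
Let X := D (true, b).
Let Y := D (true, a).
Let G := gen_diagram ab.

Definition surgery : diagram n := Diagram (surgery_planar ab Dab).

Let abn : a != b. Proof. by rewrite -val_eqE /= ab; lia. Qed.
Let Xa : X != (true, a).
Proof. by apply: contraNneq Dab => e; rewrite -e diagram_inv. Qed.
Let Xb : X != (true, b). Proof. exact: diagram_fp. Qed.
Let Ya : Y != (true, a). Proof. exact: diagram_fp. Qed.
Let XY : X != Y.
Proof. by rewrite (inj_eq (@diagram_inj _ D)) xpair_eqE eq_sym. Qed.

Lemma surgeryE v : surgery v =
  if v == (true, a) then (true, b) else if v == (true, b) then (true, a)
             else if v == X then Y else if v == Y then X else D v.
Proof. by rewrite ffunE. Qed.

Lemma surgeryX : surgery X = Y.
Proof. by rewrite surgeryE (negbTE Xa) (negbTE Xb) eqxx. Qed.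

Lemma surgeryY : surgery Y = X.
Proof. by rewrite -surgeryX diagram_inv. Qed.

(** An outer vertex in the component of x: a middle vertex other than a and b is
    joined to the top vertex above it, and both a and b are joined to X. *)
Let rep (x : vertex n + 'I_n) : vertex n :=
  match x with
  | inl v => v
  | inr j => if (j == a) || (j == b) then X else (true, j)
  end.

Let rep_lower v : rep (lower_vertex v) =
  if (v == (true, a)) || (v == (true, b)) then X else v.
Proof. by case: v => [[] j] /=; rewrite /lower_vertex /= ?xpair_eqE. Qed.

Lemma stack_sym : symmetric (stack G D).
Proof.
suff h x y : stack G D x y -> stack G D y x by move=> x y; apply/idP/idP; apply: h.
case/orP=> /existsP[v /andP[/eqP-> /eqP->]]; apply/orP; [left|right].
  by apply/existsP; exists (D v); rewrite diagram_inv !eqxx.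
by apply/existsP; exists (G v); rewrite diagram_inv !eqxx.
Qed.

Let stack_lower v : stack G D (lower_vertex v) (lower_vertex (D v)).
Proof. by apply/orP; left; apply/existsP; exists v; rewrite !eqxx. Qed.

Let stack_upper v : stack G D (upper_vertex v) (upper_vertex (G v)).
Proof. by apply/orP; right; apply/existsP; exists v; rewrite !eqxx. Qed.

(** Along an edge the representative stays within {v, surgery v}, which bounds the
    connected components from above. *)
Let stack_rep x y : stack G D x y -> rep y = rep x \/ rep y = surgery (rep x).
Proof.
case/orP=> /existsP[v /andP[/eqP-> /eqP->]].
  rewrite !rep_lower.
  case: (eqVneq v (true, a)) => [->|va] /=.
    by right; rewrite surgeryX (negbTE Ya) (negbTE Dab).
  case: (eqVneq v (true, b)) => [->|vb] /=.
    by left; rewrite (negbTE Xa) (negbTE Xb).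
  case: (eqVneq v X) => [->|vX]; first by left; rewrite diagram_inv eqxx orbT.
  case: (eqVneq v Y) => [->|vY]; first by right; rewrite diagram_inv eqxx surgeryY.
  right; rewrite surgeryE (negbTE va) (negbTE vb) (negbTE vX) (negbTE vY).
  by rewrite !diagram_eqC (negbTE vX) (negbTE vY).
rewrite ffunE /upper_vertex; case: v => [t j] /=.
have ba : (b == a) = false by rewrite eq_sym (negbTE abn).
have [->|ja] /= := eqVneq j a.
  by case: t => /=; [right; rewrite surgeryE eqxx|left; rewrite !eqxx orbT].
have [->|jb] /= := eqVneq j b.
  case: t => /=; [right|left]; last by rewrite !eqxx orbT.
  by rewrite surgeryE xpair_eqE ba andbF eqxx.
by case: t => /=; left; rewrite (negbTE ja) (negbTE jb).
Qed.

Let connect_rep x y : connect (stack G D) x y -> rep y = rep x \/ rep y = surgery (rep x).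
Proof.
case/connectP=> p; elim: p x => [|z p IH] x /=; first by move=> _ ->; left.
case/andP=> xz zp yp; have := IH _ zp yp; have := stack_rep xz.
by case=> ->; case=> ->; rewrite ?diagram_inv; auto.
Qed.

Let sconnect_sym : connect_sym (stack G D).
Proof. by apply: sym_connect_sym; apply: stack_sym. Qed.

Let connect_lower v : v != (true, a) -> v != (true, b) ->
  connect (stack G D) (lower_vertex v) (inl v).
Proof.
case: v => [[] j] /=; rewrite ?xpair_eqE //= => ja jb.
by apply: connect1; have := stack_upper (false, j); rewrite ffunE /= (negbTE ja) (negbTE jb).
Qed.

Let connect_mid_b : connect (stack G D) (inr b) (inl X).
Proof. exact: connect_trans (connect1 (stack_lower (true, b))) (connect_lower Xa Xb). Qed.

Let connect_mid_ab : connect (stack G D) (inr a) (inr b).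
Proof. by apply: connect1; have := stack_upper (false, a); rewrite ffunE /= eqxx. Qed.

Let connect_to_rep x : connect (stack G D) x (inl (rep x)).
Proof.
case: x => [v|j] /=; first exact: connect0.
case: (eqVneq j a) => [->|ja] /=; first exact: connect_trans connect_mid_ab connect_mid_b.
case: (eqVneq j b) => [->|jb] //=.
by apply: (@connect_lower (true, j)); rewrite xpair_eqE.
Qed.

Let connect_surgery u : connect (stack G D) (inl u) (inl (surgery u)).
Proof.
have cab : connect (stack G D) (inl (true, a)) (inl (true, b)).
  by apply: connect1; have := stack_upper (true, a); rewrite ffunE /= eqxx.
have cXY : connect (stack G D) (inl X) (inl Y).
  rewrite sconnect_sym; apply: connect_trans (connect_trans connect_mid_ab connect_mid_b).
  rewrite sconnect_sym.
  exact: connect_trans (connect1 (stack_lower (true, a))) (connect_lower Ya Dab).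
rewrite surgeryE; case: eqVneq => [->//|ua]; case: eqVneq => [->|ub].
  by rewrite sconnect_sym.
case: eqVneq => [->//|uX]; case: eqVneq => [->|uY]; first by rewrite sconnect_sym.
apply: (@connect_trans _ _ (lower_vertex u)); first by rewrite sconnect_sym connect_lower.
apply: connect_trans (connect1 (stack_lower u)) _.
by apply: connect_lower; rewrite diagram_eqC.
Qed.

Lemma stack_diagram_surgery D' : stack_diagram G D D' = (D' == surgery).
Proof.
have S : stack_diagram G D surgery.
  apply/forallP=> u; apply/forallP=> v; apply/eqP; apply/idP/idP => [/eqP <-|].
    by rewrite eq_sym diagram_fp connect_surgery.
  by case/andP=> uv /connect_rep /= [e|->]; rewrite ?eqxx // e eqxx in uv *.
apply/idP/eqP => [S'|->//]; apply/val_inj/ffunP => u; apply/eqP.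
by have /eqP-> := forallP (forallP S' u) (surgery u); rewrite -(eqP (forallP (forallP S u) _)).
Qed.

(** Every vertex of the stack is joined to its outer representative. *)
Lemma loops_surgery : loops G D = 0%N.
Proof.
apply: eq_card0 => x; rewrite !inE; apply/negbTE; rewrite negb_and; apply/orP; right.
by apply/forallPn; exists (rep x); rewrite negbK connect_to_rep.
Qed.

Lemma TL_mul_gen (K : fieldType) (q : K) :
  TL_mul q (dg K G) (dg K D) = dg K surgery.
Proof.
rewrite /TL_mul (bigD1 G) //= [X in _ + X]big1 ?addr0 => [|D2 D2G]; last first.
  rewrite big1 // => D1 _; rewrite big1 // => D' _.
  by rewrite !ffunE (negbTE D2G) !mul0r scale0r.
rewrite (bigD1 D) //= [X in _ + X]big1 ?addr0 => [|D1 D1D]; last first.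
  by rewrite big1 // => D' _; rewrite !ffunE (negbTE D1D) mulr0 mul0r scale0r.
rewrite (eq_bigl _ _ stack_diagram_surgery) big_pred1_eq.
by rewrite !ffunE !eqxx loops_surgery !mul1r expr0 scale1r.
Qed.
End Stack.

(** * Diagrams as words of parentheses *)

Section Orientation.
Variables (n k : nat).
Hypothesis kn : (k <= n)%N.
Implicit Types (D : diagram n) (u v : vertex n) (w : n.-tuple bool).

(** The position of v on the boundary read from the wall: this rotates the cyclic
    order so that the left bottom vertices come first, going away from the wall,
    and the right ones come last. *)
Definition wall_pos v : nat :=
  if (n - k <= bpos v)%N then (bpos v - (n - k))%N else (bpos v + (n + k))%N.

Definition opens D v : bool := (wall_pos v < wall_pos (D v))%N.

Let bpos_lt v : (bpos v < 2 * n)%N.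
Proof. by case: v => [[] [j hj]]; rewrite /bpos /=; lia. Qed.

Lemma wall_pos_inj : injective wall_pos.
Proof.
move=> u v; rewrite /wall_pos => e; apply: bpos_inj; move: e.
have hu := bpos_lt u; have hv := bpos_lt v; do 2!case: leqP => ?; lia.
Qed.

(** Being non-crossing is invariant under rotation of the cyclic order. *)
Lemma wall_noncrossing D u v :
  (wall_pos u < wall_pos v)%N -> (wall_pos v < wall_pos (D u))%N ->
  (wall_pos (D u) < wall_pos (D v))%N -> False.
Proof.
have := @diagram_noncrossing _ D u v; have := @diagram_noncrossing _ D v (D u).
have := @diagram_noncrossing _ D (D u) (D v); have := @diagram_noncrossing _ D (D v) u.
have hu := bpos_lt u; have hv := bpos_lt v.
have hDu := bpos_lt (D u); have hDv := bpos_lt (D v).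
rewrite !diagram_inv /wall_pos => n1 n2 n3 n4.
case: (leqP _ (bpos u)) => ?; case: (leqP _ (bpos v)) => ?;
case: (leqP _ (bpos (D u))) => ?; case: (leqP _ (bpos (D v))) => ?; lia.
Qed.

Lemma opensN D v : opens D (D v) = ~~ opens D v.
Proof.
rewrite /opens diagram_inv -leqNgt ltn_neqAle; case: eqVneq => // /wall_pos_inj e.
by have := diagram_fp D v; rewrite e eqxx.
Qed.

(** A word of parentheses can be matched in only one way.  By induction on the
    length of a link of D1 from v to y, both diagrams match the vertices inside the
    link alike; hence D2 cannot link v to one of these.  If D2 linked v beyond y,
    then y would close a link of D2 starting inside, which is impossible too. *)
Lemma diagram_eq_opens D1 D2 : opens D1 =1 opens D2 -> D1 = D2.
Proof.
move=> o12.
have key m v : (wall_pos (D1 v) - wall_pos v < m)%N -> opens D1 v -> D2 v = D1 v.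
  elim: m v => // m IH v vm ov.
  have inside x : (wall_pos v < wall_pos x < wall_pos (D1 v))%N ->
      (wall_pos v < wall_pos (D1 x) < wall_pos (D1 v))%N /\ D2 x = D1 x.
    move=> /andP[vx xv].
    have xin : (wall_pos v < wall_pos (D1 x) < wall_pos (D1 v))%N.
      have := @wall_noncrossing D1 v x vx xv; have := @wall_noncrossing D1 (D1 x) v.
      rewrite diagram_inv => h1 h2.
      have n1 : D1 x != D1 v by apply: contraTneq vx => /diagram_inj ->; rewrite ltnn.
      have n2 : D1 x != v by apply: contraTneq xv => <-; rewrite diagram_inv ltnn.
      rewrite !ltn_neqAle !(inj_eq wall_pos_inj) n1 eq_sym n2 /=.
      apply/andP; split; rewrite leqNgt; apply/negP => hh; first exact: h1.
      exact: h2.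
    split=> //; case/andP: xin => vDx Dxv.
    case ox: (opens D1 x); first by apply: IH => //; move: vm ox; rewrite /opens; lia.
    have := opensN D1 x; rewrite ox => oDx.
    have : D2 (D1 x) = x.
      rewrite -[RHS](diagram_inv D1); apply: IH; last by rewrite oDx.
      by move: vm oDx; rewrite /opens diagram_inv; lia.
    by move=> e; rewrite -[in LHS]e diagram_inv.
  have ov2 : opens D2 v by rewrite -o12.
  apply: wall_pos_inj; case: (ltngtP (wall_pos (D2 v)) (wall_pos (D1 v))) => // lt.
    have [|_] := inside (D2 v); first by rewrite lt andbT.
    by rewrite diagram_inv => /(congr1 D1); rewrite diagram_inv => e; rewrite e ltnn in lt.
  pose x := D2 (D1 v).
  have cx : (wall_pos x < wall_pos (D1 v))%N.
    have : opens D2 (D2 (D1 v)) by rewrite opensN -o12 opensN ov.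
    by rewrite /opens diagram_inv.
  have D2x : D2 x = D1 v by rewrite diagram_inv.
  have vx : (wall_pos v < wall_pos x)%N.
    rewrite ltnNge leq_eqVlt; apply/negP => /orP[/eqP/wall_pos_inj e|xv].
      by move: lt; rewrite -D2x e ltnn.
    by apply: (@wall_noncrossing D2 x v xv); rewrite D2x //; apply: ov.
  have [|_ e] := inside x; first by rewrite vx.
  by rewrite D2x in e; move: vx; rewrite (diagram_inj e) ltnn.
apply/val_inj/ffunP => v; case ov: (opens D1 v).
  by rewrite -(key _ v (ltnSn _) ov).
have ov' : opens D1 (D1 v) by rewrite opensN ov.
have := key _ _ (ltnSn _) ov'; rewrite diagram_inv => e.
by rewrite -[in RHS]e /= diagram_inv.
Qed.

(** This is how membership in the diagrammatic basis reads on parentheses, see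
    [basis_oriented]. *)
Definition oriented D := forall j, opens D (false, j) = leftmost k j.

Ltac wall_lia := rewrite /wall_pos /bpos /leftmost /=;
  repeat (case: (leqP (n - k) _) => ?); lia.

Lemma basis_oriented D : diagrammatic_basis k D -> oriented D.
Proof.
move=> bD j; have h := bD j; rewrite /opens; case: (D (false, j)) h => [[] i] h.
  by have hi := ltn_ord i; have hj := ltn_ord j; wall_lia.
by have hi := ltn_ord i; have hj := ltn_ord j; have [] := h i erefl; wall_lia.
Qed.

Definition top_word D : n.-tuple bool := [tuple opens D (true, j) | j < n].

(** The signs of the top word extended to the bottom line: the sign at a left bottom
    vertex is +, so that opening ends of [top_word] always have +, see
    [bsign_top_word]. *)
Definition bsign w v : bool := if v.1 then tnth w v.2 else leftmost k v.2.

Lemma bsign_top_word D v : oriented D -> bsign (top_word D) v = opens D v.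
Proof. by case: v => [[] j] oD; rewrite /bsign /= ?tnth_mktuple ?oD. Qed.

Lemma oriented_top_word_inj D1 D2 :
  oriented D1 -> oriented D2 -> top_word D1 = top_word D2 -> D1 = D2.
Proof.
by move=> o1 o2 e; apply: diagram_eq_opens => v; rewrite -!bsign_top_word // e.
Qed.

Definition compatible D w : bool := [forall v, bsign w (D v) == ~~ bsign w v].

Lemma compatibleP D w :
  reflect (forall v, bsign w (D v) = ~~ bsign w v) (compatible D w).
Proof. exact: 'forall_eqP. Qed.

Lemma oriented_id : oriented (id_diagram n).
Proof.
by move=> j; rewrite /opens ffunE; have hj := ltn_ord j; wall_lia.
Qed.

Lemma top_word_id : top_word (id_diagram n) = [tuple (j < n - k)%N | j < n].
Proof.
apply: eq_from_tnth => j; rewrite !tnth_mktuple /opens ffunE.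
by have hj := ltn_ord j; wall_lia.
Qed.

Lemma top_opens (a b : 'I_n) : (a < b)%N ->
  (wall_pos (true, b) < wall_pos (true, a))%N.
Proof. by move=> ab; have hb := ltn_ord b; wall_lia. Qed.

Section Step.
Variables (D : diagram n) (a b : 'I_n).
Hypotheses (ab : b = a.+1 :> nat) (oD : oriented D).
Hypotheses (oa : opens D (true, a)) (ob : ~~ opens D (true, b)).

(** A cup opens at its left end, so a cannot be the opening end of a cup to b. *)
Lemma step_not_linked : D (true, a) != (true, b).
Proof.
apply: contraTneq oa => e; rewrite /opens e -leqNgt ltnW //.
by apply: top_opens; rewrite ab.
Qed.

Let S := surgery ab step_not_linked.
Let X := D (true, b).
Let Y := D (true, a).

Let ban : (true, b) != (true, a) :> vertex n.
Proof. by rewrite xpair_eqE /= -val_eqE /= ab; lia. Qed.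
Let Xa : X != (true, a).
Proof. by apply: contraNneq step_not_linked => e; rewrite -e diagram_inv. Qed.
Let Xb : X != (true, b). Proof. exact: diagram_fp. Qed.

(** The vertex X opens in D because b closes, and Y closes because a opens; so the
    link from X to Y has its ends oriented as before, and only a and b change. *)
Lemma opens_surgery v : opens S v =
  (v == (true, b)) || (v != (true, a)) && opens D v.
Proof.
have ltab : (wall_pos (true, b) < wall_pos (true, a))%N by apply: top_opens; rewrite ab.
have ltX : (wall_pos X < wall_pos (true, b))%N by have := ob; rewrite -opensN /opens diagram_inv.
have ltY : (wall_pos (true, a) < wall_pos Y)%N by apply: oa.
rewrite /opens surgeryE; case: (eqVneq v (true, a)) => [->|va].
  by rewrite eq_sym (negbTE ban) ltnNge ltnW.
case: (eqVneq v (true, b)) => [->|vb] //=.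
case: (eqVneq v X) => [->|vX].
  rewrite diagram_inv ltX.
  by rewrite (ltn_trans ltX) // (ltn_trans ltab).
case: (eqVneq v Y) => [->|vY] //.
rewrite diagram_inv ltnNge [RHS]ltnNge (ltnW ltY) /= ltnW //.
by rewrite (ltn_trans ltX) // (ltn_trans ltab).
Qed.

Lemma oriented_surgery : oriented S.
Proof. by move=> j; rewrite opens_surgery !xpair_eqE /= oD. Qed.

Lemma top_word_surgery : top_word S = replace2 (top_word D) a b true false.
Proof.
apply: eq_from_tnth => j; rewrite tnth_replace2 !tnth_mktuple opens_surgery !xpair_eqE /=.
by case: eqVneq => // _; case: eqVneq.
Qed.

End Step.

Section Coef.
Variables (K : fieldType) (q : K).
Hypothesis q0 : q != 0.

(** D evaluated as a network of tensors: bottom vertices have fixed signs, top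
    vertices the signs of w, and every link is a copy of delta. *)
Definition weight D w : K := \prod_(v | opens D v) delta q (bsign w v) (bsign w (D v)).

Definition diagram_vec D : Vt K n := [ffun w => weight D w].

(** A link with equal signs at its ends contributes 0, a link with signs + - from
    its opening to its closing end contributes 1, and one with - + contributes
    -q^-1. *)
Lemma weightE D w : weight D w =
  if compatible D w then (- q^-1) ^+ #|[set v | opens D v && ~~ bsign w v]| else 0.
Proof.
case: ifP => [/compatibleP c|/negbT].
  rewrite -prodr_const /weight big_mkcond [RHS]big_mkcond; apply: eq_bigr => v _.
  by rewrite inE c; case: (opens D v) (bsign w v) => [] [].
rewrite negb_forall => /existsP[v h].
have {h} e : bsign w (D v) = bsign w v by case: (bsign w _) (bsign w _) h => [] [].
wlog ov : v e / opens D v.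
  move=> h; case ov: (opens D v); first exact: (h v).
  by apply: (h (D v)); rewrite ?diagram_inv ?opensN ?ov.
by rewrite /weight (bigD1 v) //= e; case: (bsign w v); rewrite mul0r.
Qed.

Lemma diagram_vec_id : diagram_vec (id_diagram n) = vmp K n k.
Proof.
apply/ffunP=> w; rewrite !ffunE weightE -top_word_id.
have oI := oriented_id.
case: eqVneq => [->|wn].
  case: ifP => [_|/compatibleP[] v]; last by rewrite !bsign_top_word ?opensN.
  rewrite (_ : [set _ | _] = set0) ?cards0 //.
  by apply/setP=> v; rewrite !inE bsign_top_word // andbN.
case: ifP => // /compatibleP c; case/eqP: wn.
apply: eq_from_tnth => j; have := c (false, j).
rewrite {1}/bsign ffunE /= /bsign /= => ->.
by rewrite -oI -opensN -bsign_top_word // ffunE /bsign /= .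
Qed.

(** The zigzag identity: with X and Y linked to the top vertices b and a,
    contracting delta at (X, b) and delta at (a, Y) with eps at (b, a) gives delta
    at (X, Y).  All other links contribute the same on both
    sides. *)
Lemma gen_act_diagram_vec D (a b : 'I_n) (ab : b = a.+1 :> nat)
    (oa : opens D (true, a)) : ~~ opens D (true, b) ->
  gen_act q a b (diagram_vec D) = diagram_vec (surgery ab (step_not_linked ab oa)).
Proof.
move=> ob; set S := surgery _ _.
pose X : vertex n := D (true, b); pose Y : vertex n := D (true, a).
have Xa : X != (true, a).
  by apply: contraNneq (step_not_linked ab oa) => e; rewrite -e diagram_inv.
have Xb : X != (true, b) by apply: diagram_fp.
have abn : a != b by rewrite -val_eqE /= ab; lia.
have SX : S X = Y by apply: surgeryX.
have Sb : S (true, b) = (true, a).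
  by rewrite (_ : (true, b) = S (true, a)) ?diagram_inv // surgeryE eqxx.
have oS := opens_surgery ab oa ob.
have oSb : opens S (true, b) by rewrite oS eqxx.
have oX : opens D X by rewrite opensN.
have oSX : opens S X.
  by rewrite oS; apply/orP; right; apply/andP.
have oY : ~~ opens D Y by rewrite opensN oa.
apply/ffunP=> w; rewrite gen_actE // [RHS]ffunE.
pose rest := \prod_(v | [&& opens D v, v != (true, a) & v != X])
  delta q (bsign w v) (bsign w (D v)).
have bsignr v l r : v != (true, a) -> v != (true, b) ->
    bsign (replace2 w a b l r) v = bsign w v.
  case: v => [[] j]; rewrite /bsign //= !xpair_eqE /= => ja jb.
  by rewrite tnth_replace2 (negbTE ja) (negbTE jb).
have -> : weight S w = delta q (tnth w b) (tnth w a) * (delta q (bsign w X) (bsign w Y) * rest).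
  rewrite /weight (bigD1 (true, b)) ?oSb // (bigD1 X); last by apply/andP.
  rewrite SX Sb; congr (_ * (_ * _)).
  apply: eq_big => v.
    rewrite oS; case: (eqVneq v (true, b)) => [->|vb] /=.
      by rewrite (negbTE ob).
    by case: (v == (true, a)); case: (opens D v); rewrite ?andbF ?andbT.
  case/andP=> /andP[]; rewrite oS => h vb vX; move: h.
  rewrite (negbTE vb) /= => /andP[va ov].
  have vY : v != Y by apply: contraTneq ov => ->.
  by rewrite (surgeryE ab (step_not_linked ab oa)) !ifN.
have E l r : diagram_vec D (replace2 w a b l r) =
    delta q r (bsign w Y) * (delta q (bsign w X) l * rest).
  rewrite ffunE /weight (bigD1 (true, a)) //= (bigD1 X) /=; last by rewrite oX Xa.
  have bsigna : bsign (replace2 w a b l r) (true, a) = r.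
    by rewrite /bsign /= tnth_replace2 (negbTE abn) eqxx.
  have bsignb : bsign (replace2 w a b l r) (true, b) = l.
    by rewrite /bsign /= tnth_replace2 eqxx.
  rewrite bsigna diagram_inv bsignb !bsignr ?(step_not_linked ab oa) ?diagram_fp //.
  congr (_ * (_ * _)); apply: eq_big => v; first by rewrite andbA.
  case/andP=> /andP[ov va] vX.
  have vb : v != (true, b) by apply: contraTneq ov => ->.
  by rewrite !bsignr // diagram_eqC //; apply: contraTneq ov => ->.
congr (_ * _); rewrite !big_bool /= !E.
by case: (bsign w X) (bsign w Y) => [] [] /=; field.
Qed.
End Coef.
End Orientation.

(** * Reaching the diagrammatic basis by generators *)

Section Words.
Variables (n k : nat).
Hypothesis kn : (k <= n)%N.
Implicit Types (w : n.-tuple bool) (D : diagram n).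

Definition nplus w : nat := (\sum_(j < n) tnth w j)%N.

Lemma sum_lt m : (m <= n)%N -> (\sum_(j < n) (j < m) = m)%N.
Proof.
by move=> mn; rewrite -big_mkcond -(big_ord_widen _ (fun=> 1%N) mn) sum1_card card_ord.
Qed.

(** As many vertices open as close, and on the bottom k open and n-k close. *)
Lemma nplus_top_word D : oriented k D -> nplus (top_word k D) = (n - k)%N.
Proof.
move=> oD.
have sumv (F : vertex n -> nat) :
    (\sum_v F v = \sum_(j < n) F (true, j) + \sum_(j < n) F (false, j))%N.
  transitivity (\sum_t \sum_(j < n) F (t, j))%N; last by rewrite big_bool.
  by rewrite pair_big; apply: eq_bigr => -[].
have e1 : (\sum_v opens k D v = \sum_v ~~ opens k D v)%N.
  rewrite (reindex_inj (@diagram_inj _ D)) /=; apply: eq_bigr => v _.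
  by rewrite opensN.
have c (F : 'I_n -> bool) : (\sum_j F j + \sum_j ~~ F j = n)%N.
  rewrite -big_split /= -[RHS]card_ord -sum1_card; apply: eq_bigr => j _.
  by case: (F j).
have e2 : (\sum_(j < n) ~~ opens k D (false, j) = n - k)%N.
  rewrite -[RHS](sum_lt (leq_subr k n)); apply: eq_bigr => j _.
  by rewrite oD /leftmost -ltnNge.
have := c (fun j => opens k D (true, j)); have := c (fun j => opens k D (false, j)).
have -> : nplus (top_word k D) = (\sum_(j < n) opens k D (true, j))%N.
  by apply: eq_bigr => j _; rewrite tnth_mktuple.
move: e1; rewrite !sumv e2.
move: (\sum_j opens k D (true, j))%N (\sum_j opens k D (false, j))%N.
by move: (\sum_j ~~ opens k D (true, j))%N => x y z; lia.
Qed.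

Lemma sum_replace2 (F : 'I_n -> bool -> nat) w a b l r : a != b ->
  (\sum_j F j (tnth (replace2 w a b l r) j) + (F b (tnth w b) + F a (tnth w a)) =
   \sum_j F j (tnth w j) + (F b l + F a r))%N.
Proof.
move=> ab; rewrite (bigD1 b) //= (bigD1 a) //= [X in _ = (X + _)%N](bigD1 b) //=.
rewrite [X in _ = (_ + X + _)%N](bigD1 a) //= !tnth_replace2 !eqxx (negbTE ab).
set s1 := (\sum_(i < n | _) _)%N; set s2 := (\sum_(i < n | _) _)%N.
have -> : s1 = s2.
  apply: eq_bigr => j /andP[jb ja].
  by rewrite tnth_replace2 (negbTE jb) (negbTE ja).
by lia.
Qed.

(** Exchanging a neighbouring + - into - + lowers the sum of the positions of the
    plus signs.  If no such pair is left, then the plus signs form an initial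
    segment of the positions, of length n-k. *)
Lemma word_ind (P : n.-tuple bool -> Prop) :
  P [tuple (j < n - k)%N | j < n] ->
  (forall w (a b : 'I_n), b = a.+1 :> nat -> tnth w a -> ~~ tnth w b ->
     P w -> P (replace2 w a b true false)) ->
  forall w, nplus w = (n - k)%N -> P w.
Proof.
move=> P0 PS w; have [m] := ubnP (\sum_(j < n) j * tnth w j)%N.
elim: m w => // m IH w wm pw.
case: (boolP [exists a : 'I_n, exists b : 'I_n,
   [&& b == a.+1 :> nat, tnth w b & ~~ tnth w a]]).
  case/existsP=> a /existsP[b /and3P[/eqP ab wb wa]].
  have abn : a != b by rewrite -val_eqE /= ab; lia.
    (* The pair is exchanged back; w is recovered from w' by a generator step. *)
pose w' := replace2 w a b false true.
  have -> : w = replace2 w' a b true false.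
    apply: eq_from_tnth => j; rewrite !tnth_replace2.
    case: eqVneq => [->|_]; first by rewrite wb.
    by case: eqVneq => [->|_] //; rewrite (negbTE wa).
  apply: PS => //; rewrite ?tnth_replace2 ?eqxx ?(negbTE abn) //.
  apply: IH.
    have := sum_replace2 (fun (j : 'I_n) t => (j * t)%N) w false true abn.
    rewrite wb (negbTE wa) /= -/w'; move: wm.
    by set x := (\sum_j _)%N; set y := (\sum_j _)%N; lia.
  have := sum_replace2 (fun j t => nat_of_bool t) w false true abn.
  rewrite wb (negbTE wa) /= -/w'; move: pw; rewrite /nplus.
  by set x := (\sum_j _)%N; set y := (\sum_j _)%N; lia.
move=> no.
have down (j i : 'I_n) : (i <= j)%N -> tnth w j -> tnth w i.
  move=> ij wj; have [d dE] : exists d, (j = i + d :> nat)%N by exists (j - i)%N; lia.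
  elim: d i j dE {ij} wj => [|d IHd] i j e wj.
    by rewrite (_ : i = j) //; apply: val_inj; rewrite /= e addn0.
  have hi : (j.-1 < n)%N by have := ltn_ord j; lia.
  apply: (IHd i (Ordinal hi)) => /=; first by lia.
  apply: contraNT no => wi; apply/existsP; exists (Ordinal hi); apply/existsP; exists j.
  by rewrite wj wi /= !andbT; apply/eqP; lia.
suff -> : w = [tuple (j < n - k)%N | j < n] by [].
apply: eq_from_tnth => j; rewrite tnth_mktuple.
have jn := ltn_ord j.
case wj: (tnth w j).
  have : (\sum_(i < n) (i < j.+1) <= nplus w)%N.
    apply: leq_sum => i _; case: ltnP => //; rewrite ltnS => ij.
    by rewrite (down _ _ ij wj).
  by rewrite sum_lt // pw => ->.
have : (nplus w <= \sum_(i < n) (i < j))%N.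
  apply: leq_sum => i _; case wi: (tnth w i) => //.
  by case: ltnP => // ji; rewrite (down _ _ ji wi) in wj.
by rewrite sum_lt ?(ltnW jn) // pw => h; rewrite ltnNge h.
Qed.
End Words.

Section Realise.
Variables (n k : nat) (K : fieldType) (q : K) (bar : {rmorphism K -> K}).
Hypotheses (kn : (k <= n)%N) (q0 : q != 0) (barq : bar q = q^-1).
Variable rho : {linear TL K n -> 'End(Vt K n)}.
Hypothesis act : is_TL_action q rho.

Lemma word_realised (w : n.-tuple bool) : nplus w = (n - k)%N ->
  exists D : diagram n, [/\ oriented k D, top_word k D = w,
     ind_embedding rho k (dg K D) = diagram_vec k q D &
     psi q bar (diagram_vec k q D) = diagram_vec k q D].
Proof.
case: act => rho1 rhoM rhoG.
move: w; apply: (word_ind kn) => [|w a b ab wa wb [D [oD Dw rD pD]]].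
  exists (id_diagram n); split; first exact: oriented_id.
  - exact: top_word_id.
  - by rewrite diagram_vec_id // /ind_embedding -/(TL_one K n) rho1 id_lfunE.
  - by rewrite diagram_vec_id // psi_vmp.
have oa : opens k D (true, a) by move: wa; rewrite -Dw tnth_mktuple.
have ob : ~~ opens k D (true, b) by move: wb; rewrite -Dw tnth_mktuple.
have E := gen_act_diagram_vec kn q0 ab oa ob.
exists (surgery ab (step_not_linked kn ab oa)); split.
- by apply: oriented_surgery.
- by rewrite top_word_surgery // Dw.
- rewrite /ind_embedding -(TL_mul_gen ab (step_not_linked kn ab oa) q) rhoM comp_lfunE.
  by rewrite rhoG -E -rD.
- by rewrite -E psi_gen_act // pD.
Qed.

(** D is the diagram that [word_realised] produces for the top word of D, since a
    diagram of the basis is determined by this word. *)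
Lemma ind_embedding_basis D : diagrammatic_basis k D ->
  ind_embedding rho k (dg K D) = diagram_vec k q D /\
  psi q bar (diagram_vec k q D) = diagram_vec k q D.
Proof.
move=> /(basis_oriented kn) oD.
have [D' [oD' wD' rD' pD']] := word_realised (nplus_top_word kn oD).
by rewrite -(oriented_top_word_inj kn oD' oD wD').
Qed.
End Realise.

(** * Transversals of the top links *)

Section Transversals.
Variables (n k : nat).
Hypothesis kn : (k <= n)%N.
Variable D : diagram n.
Hypothesis oD : oriented k D.
Implicit Types (I : {set 'I_n}) (w : n.-tuple bool) (j : 'I_n).

Definition on_cup j : bool := (D (true, j)).1.
(** Fixing the vertices of through links makes this a permutation of all top
    positions, so that sums over them can be reindexed. *)
Definition mate j : 'I_n := if on_cup j then (D (true, j)).2 else j.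

Lemma cupE j : on_cup j -> D (true, j) = (true, mate j).
Proof. by rewrite /mate /on_cup; case: (D (true, j)) => t i /= ->. Qed.

Lemma cup_mate j : on_cup (mate j) = on_cup j.
Proof.
case c: (on_cup j); last by rewrite /mate c.
by rewrite /on_cup -(cupE c) diagram_inv.
Qed.

Lemma mateK : involutive mate.
Proof.
move=> j; case c: (on_cup j); last by rewrite /mate !c.
have c' : on_cup (mate j) by rewrite cup_mate.
by have := cupE c'; rewrite -(cupE c) diagram_inv => -[].
Qed.

Lemma mate_neq j : on_cup j -> mate j != j.
Proof.
move=> c; apply: contraTneq isT => e; have := diagram_fp D (true, j).
by rewrite (cupE c) e eqxx.
Qed.

Lemma cup_opens j : on_cup j -> opens k D (true, j) = (mate j < j)%N.
Proof.
move=> c; rewrite /opens (cupE c).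
case: (ltngtP (mate j) j) => h; last by have := mate_neq c; rewrite -val_eqE /= h eqxx.
  exact: top_opens.
by apply/negbTE; rewrite -leqNgt ltnW // top_opens.
Qed.

(** The left ends represent the cups, one for each top link. *)
Definition left_ends : {set 'I_n} := [set j | on_cup j && (mate j < j)%N].
Definition cup_of j : {set 'I_n} := [set j; mate j].

Lemma top_linksE : top_links D = cup_of @: left_ends.
Proof.
apply/setP=> C; apply/imsetP/imsetP => [[[i j] /=]|[j]].
  rewrite inE /= => /eqP e ->.
  have ci : on_cup i by rewrite /on_cup e.
  have mi : mate i = j by rewrite /mate ci e.
  case: (ltngtP i j) => h; last 2 first.
  - by exists i; rewrite ?inE ?ci ?mi // /cup_of mi.
  - by have := mate_neq ci; rewrite mi -val_eqE /= h eqxx.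
  exists j; first by rewrite inE -mi cup_mate ci mateK mi.
  by rewrite /cup_of -mi mateK setUC.
rewrite inE => /andP[c h] ->; exists (j, mate j) => //.
by rewrite inE /= (cupE c).
Qed.

Lemma cup_of_inj : {in left_ends &, injective cup_of}.
Proof.
move=> i j; rewrite !inE => /andP[ci hi] /andP[cj hj] e.
have : i \in cup_of j by rewrite -e set21.
rewrite !inE => /orP[/eqP//|/eqP ij].
have : j \in cup_of i by rewrite e set21.
rewrite !inE => /orP[/eqP//|/eqP ji].
by move: hi hj; rewrite -ij -ji; lia.
Qed.

Definition splits_cups I : Prop := forall j, on_cup j -> (mate j \in I) = (j \notin I).

(** Counting each side together with its image under [mate] gives the number of
    vertices on cups, in both cases. *)
Lemma card_splits_cups I : splits_cups I -> #|[set j in I | on_cup j]| = #|left_ends|.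
Proof.
move=> eI; rewrite -!sum1_card big_mkcond [RHS]big_mkcond /=.
have double (F : 'I_n -> nat) : ((\sum_j F j).*2 = \sum_j (F j + F (mate j)))%N.
  by rewrite big_split /= -addnn [in X in (X + _)%N](reindex_inj (inv_inj mateK)) addnC;
     congr addn; rewrite [RHS](reindex_inj (inv_inj mateK)).
apply: double_inj; rewrite !double; apply: eq_bigr => j _.
rewrite !inE mateK cup_mate; case c: (on_cup j); rewrite ?andbF //= !andbT eI //.
have := mate_neq c; rewrite -val_eqE /=.
by case: (j \in I); case: ltngtP.
Qed.

Definition word_of I : n.-tuple bool :=
  [tuple (if on_cup j then j \in I else ~~ leftmost k (D (true, j)).2) | j < n].

Lemma vT_word (K : fieldType) I : vT K k D I = vecs K (word_of I).
Proof. by []. Qed.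

Lemma compatible_word_of I : splits_cups I -> compatible k D (word_of I).
Proof.
move=> eI; apply/compatibleP => v.
wlog : v / v.1 || ~~ (D v).1.
  move=> h; case c: (v.1 || ~~ (D v).1); first exact: h.
  have := h (D v); rewrite diagram_inv => -> //; first by rewrite negbK.
  by move/negbT: c; rewrite negb_or negbK => /andP[_ ->].
case: v => [[] j] /= h; last first.
  have := opensN kn D (false, j); rewrite [in RHS]oD /bsign /=.
  by case: (D (false, j)) h => [[] i] //= _; rewrite oD.
rewrite {2}/bsign /= tnth_mktuple; case: ifP => c.
  by rewrite (cupE c) /bsign /= tnth_mktuple cup_mate c eI.
rewrite negbK /bsign; move: c.
by rewrite /on_cup; case: (D (true, j)) => [[] i].
Qed.

Definition plus_cups w : {set 'I_n} := [set j | on_cup j && tnth w j].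

Lemma plus_cupsK I : splits_cups I -> I \subset [set j | on_cup j] ->
  plus_cups (word_of I) = I.
Proof.
move=> eI sI; apply/setP=> j; rewrite inE tnth_mktuple.
case c: (on_cup j) => //=; apply/esym; apply: contraFF c => jI.
by have := subsetP sI j jI; rewrite inE.
Qed.

Lemma splits_plus_cups w : compatible k D w -> splits_cups (plus_cups w).
Proof.
move=> /compatibleP cw j c; rewrite !inE cup_mate c /=.
by have := cw (true, j); rewrite (cupE c).
Qed.

Lemma word_of_plus_cups w : compatible k D w -> word_of (plus_cups w) = w.
Proof.
move=> /compatibleP cw; apply: eq_from_tnth => j; rewrite tnth_mktuple inE.
case c: (on_cup j) => //=; have := cw (D (true, j)); rewrite diagram_inv /bsign /= => ->.
by move: c; rewrite /on_cup; case: (D _) => [[] i].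
Qed.

Lemma cup_inter I i j : i \in cup_of j -> (I :&: cup_of j == [set i]) =
  (i \in I) && ((mate i == i) || (mate i \notin I)).
Proof.
move=> ij; have -> : cup_of j = [set i; mate i].
  by move: ij; rewrite !inE => /orP[]/eqP-> //; rewrite mateK setUC.
apply/eqP/andP => [e|[iI mI]].
  have : i \in [set i] by rewrite inE.
  rewrite -e inE => /andP[-> _]; split=> //.
  apply/norP => -[mi]; rewrite negbK => mI.
  have : mate i \in [set i] by rewrite -e !inE mI eqxx orbT.
  by rewrite inE (negbTE mi).
apply/setP=> x; rewrite !inE; case: (eqVneq x i) => [->|xi] /=; first by rewrite iI.
apply/andP => -[xI /eqP xm]; move: mI; rewrite -xm xI orbF.
by rewrite xm; move: xi; rewrite xm => /negbTE ->.
Qed.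

(** If I contains one end of each cup, it contains as many vertices on cups as there
    are cups; the condition on the cardinality then says that I has no others. *)
Lemma transversalP I :
  reflect (splits_cups I /\ I \subset [set j | on_cup j]) (I \in transversals D).
Proof.
have cL : #|top_links D| = #|left_ends|.
  by rewrite top_linksE card_in_imset //; apply: cup_of_inj.
have subE : splits_cups I -> (#|I| == #|top_links D|) = (I \subset [set j | on_cup j]).
  move=> eI; rewrite cL -(card_splits_cups eI).
  have -> : [set j in I | on_cup j] = I :&: [set j | on_cup j].
    by apply/setP=> j; rewrite !inE.
  apply/eqP/idP => [e|/setIidPl -> //].
  by apply/setIidPl/eqP; rewrite eqEcard subsetIl e leqnn.
have meetE : (forall C, C \in top_links D -> #|I :&: C| == 1%N) <-> splits_cups I.
  split=> [h j cj|eI C].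
    have : cup_of j \in top_links D.
      rewrite top_linksE; case: (ltngtP (mate j) j) => lt.
      - by apply: imset_f; rewrite inE cj lt.
      - rewrite (_ : cup_of j = cup_of (mate j)); last by rewrite /cup_of mateK setUC.
        by apply: imset_f; rewrite inE cup_mate cj mateK lt.
      - by have := mate_neq cj; rewrite -val_eqE /= lt eqxx.
    move=> /h /cards1P[i e].
    have ij : i \in cup_of j.
      have : i \in I :&: cup_of j by rewrite e inE.
      by rewrite inE => /andP[].
    have := cup_inter I ij; rewrite e eqxx => /esym /andP[iI].
    have ci : on_cup i by move: ij; rewrite !inE => /orP[]/eqP->; rewrite ?cup_mate.
    rewrite (negbTE (mate_neq ci)) /= => mI.
    move: ij; rewrite !inE => /orP[]/eqP eij; rewrite eij in iI mI.
      by rewrite iI (negbTE mI).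
    by rewrite mateK in mI; rewrite iI mI.
  rewrite top_linksE => /imsetP[j]; rewrite inE => /andP[cj _] ->.
  apply/cards1P; case jI: (j \in I).
    exists j; apply/eqP; rewrite cup_inter ?set21 // jI eI // jI orbT //.
  exists (mate j); apply/eqP; rewrite cup_inter ?set22 // mateK eI // jI orbT //.
rewrite inE; apply: (iffP andP) => [[h1 /forallP h2]|[eI sI]].
  have eI : splits_cups I by apply/meetE => C CT; have := h2 C; rewrite CT.
  by rewrite -subE.
rewrite subE //; split=> //; apply/forallP => C; apply/implyP; apply/meetE: C.
exact: eI.
Qed.

(** Both exponents count the cups whose left end is not in I: such a cup meets I in
    its right end, which is its minimum, and the sign at its opening end is -.  The
    links with a bottom vertex always have + at their opening end. *)
Lemma sgnT_weight (K : fieldType) (q : K) I : I \in transversals D ->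
  sgnT q D I = weight k q D (word_of I).
Proof.
case/transversalP=> eI _; rewrite weightE // compatible_word_of // /sgnT; congr (_ ^+ _).
pose M := [set j in left_ends | j \notin I].
transitivity #|M|.
  rewrite -(card_in_imset (f := cup_of)); last first.
    move=> i j iM jM; apply: cup_of_inj.
      by move: iM; rewrite inE => /andP[].
    by move: jM; rewrite inE => /andP[].
  apply: eq_card => C; rewrite inE top_linksE.
  apply/andP/imsetP => [[/imsetP[j jL ->] /existsP[i /andP[/andP[ij /forallP mi] e]]]|[j]].
    exists j => //; rewrite inE jL /=.
    move: (jL); rewrite inE => /andP[cj lt].
    have := mi (mate j); rewrite set22 /= => le.
    have im : i = mate j.
      by move: ij; rewrite !inE => /orP[]/eqP // ij; move: le lt; rewrite ij; lia.
    move: e; rewrite cup_inter // => /andP[iI _].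
    by move: iI; rewrite im eI.
  rewrite inE => /andP[jL jI] ->; split; first exact: imset_f.
  move: jL; rewrite inE => /andP[cj lt].
  apply/existsP; exists (mate j); rewrite cup_inter ?set22 // mateK eI // jI orbT andbT.
  rewrite andbT /is_min set22; apply/forallP => i; apply/implyP; rewrite !inE.
  by case/orP=> /eqP-> //; apply: ltnW.
have ti : {in M &, injective (fun j => (true, j) : vertex n)} by move=> i j _ _ [].
rewrite -(card_in_imset ti); apply: eq_card => -[t j]; rewrite inE.
apply/imsetP/andP => [[x]|[ov eN]].
  rewrite !inE => /andP[/andP[c lt] iI] [-> ->].
  by rewrite cup_opens // /bsign /= tnth_mktuple c.
case: t ov eN => ov; last by rewrite /bsign /= -oD ov.
rewrite /bsign /= tnth_mktuple; case: ifP => c h.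
  by exists j => //; rewrite !inE c -cup_opens // ov.
move: h; rewrite negbK; have := opensN kn D (true, j); rewrite ov /=.
by move: c; rewrite /on_cup; case: (D (true, j)) => [[] i] //= _; rewrite oD => ->.
Qed.

(** The words of the support are those of the transversals, each obtained once: the
    transversal is the set of vertices on cups where the word has +. *)
Lemma diagram_vec_transversals (K : fieldType) (q : K) :
  diagram_vec k q D = \sum_(I in transversals D) sgnT q D I *: vT K k D I.
Proof.
apply/ffunP=> w; rewrite ffunE sum_ffunE.
under eq_bigr => I IT do rewrite vT_word !ffunE sgnT_weight //.
rewrite /GRing.scale /=.
case cw: (compatible k D w).
  have PT : plus_cups w \in transversals D.
    apply/transversalP; split; first exact: splits_plus_cups.
    by apply/subsetP => j; rewrite !inE => /andP[].
  rewrite (bigD1 (plus_cups w)) //= word_of_plus_cups // eqxx mulr1 big1 ?addr0 // => I.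
  case/andP=> /transversalP[eI sI] IP; case: eqP => [e|]; last by rewrite mulr0.
  by move: IP; rewrite e plus_cupsK // eqxx.
rewrite weightE // cw big1 // => I /transversalP[eI sI].
case: eqP => [e|]; last by rewrite mulr0.
by rewrite e compatible_word_of in cw.
Qed.
End Transversals.

(** * Triangularity *)

Section Triangular.
Variables (n k : nat).
Hypothesis kn : (k <= n)%N.
Variable D : diagram n.
Hypothesis oD : oriented k D.
Implicit Types (u w : n.-tuple bool) (j : 'I_n).

Lemma compatible_top_word : compatible k D (top_word k D).
Proof. by apply/compatibleP => v; rewrite !bsign_top_word // opensN. Qed.

Lemma compatible_mate u j : compatible k D u -> on_cup D j ->
  tnth u (mate D j) = ~~ tnth u j.
Proof. by move=> /compatibleP cu c; have := cu (true, j); rewrite (cupE c). Qed.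

Lemma compatible_through u w j : compatible k D u -> compatible k D w ->
  ~~ on_cup D j -> tnth u j = tnth w j.
Proof.
move=> /compatibleP cu /compatibleP cw c.
have := cu (true, j); have := cw (true, j); move: c; rewrite /bsign /on_cup /=.
case: (D (true, j)) => [[] i] //= _ ->.
by case: (tnth u j) (tnth w j) => [] [].
Qed.

Lemma psum_diff u w m : psum u m - psum w m =
  (\sum_(j < n) (j < m)%N%:R * ((tnth u j)%:R - (tnth w j)%:R)) *+ 2.
Proof.
rewrite /psum -sumrB big_mkcond -sumrMnl; apply: eq_bigr => j _.
by case: (j < m)%N (tnth u j) (tnth w j) => [] [] [].
Qed.

(** Passing from a vertex to its mate changes the sign of the difference between u
    and the top word; so the sum is the average of its two forms, indexed by the
    vertices and by their mates, and the factor 2 of [psum_diff] disappears. *)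
Lemma psum_double u m : compatible k D u ->
  psum u m - psum (top_word k D) m =
  \sum_(j < n) ((j < m)%N%:R - (mate D j < m)%N%:R) *
    ((tnth u j)%:R - (tnth (top_word k D) j)%:R).
Proof.
move=> cu; rewrite psum_diff mulr2n [X in _ + X](reindex_inj (inv_inj (mateK D))).
rewrite -big_split /=; apply: eq_bigr => j _; rewrite mulrBl; congr (_ + _).
case c: (on_cup D j); last first.
  by rewrite /mate c (compatible_through cu compatible_top_word) ?c // subrr mulr0 oppr0.
rewrite !(compatible_mate _ c) ?compatible_top_word //.
by case: (_ < m)%N (tnth u j) (tnth (top_word k D) j) => [] [] [].
Qed.

(** Only cups with exactly one end among the first m positions contribute.  This is
    the right end, where the top word has -, and u can only have a larger sign. *)
Lemma psum_le u m : compatible k D u -> psum (top_word k D) m <= psum u m.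
Proof.
move=> cu; rewrite -subr_ge0 psum_double //; apply: sumr_ge0 => j _.
case c: (on_cup D j); last first.
  by rewrite (compatible_through cu compatible_top_word) ?c // subrr mulr0.
rewrite tnth_mktuple cup_opens //.
case: (ltngtP (mate D j) j) => h.
- by case: (ltnP j m) => h1; case: (ltnP (mate D j) m) => h2; case: (tnth u j) => //; lia.
- by case: (ltnP j m) => h1; case: (ltnP (mate D j) m) => h2; case: (tnth u j) => //; lia.
- by have := mate_neq c; rewrite -val_eqE /= h eqxx.
Qed.

Lemma psum_total u : compatible k D u -> psum u n = psum (top_word k D) n.
Proof.
move=> cu; apply/eqP; rewrite -subr_eq0 psum_double //; apply/eqP; apply: big1 => j _.
by rewrite !ltn_ord subrr mul0r.
Qed.

Lemma in_qVZqV_opp_exp (K : fieldType) (q : K) c : in_qVZqV q ((- q^-1) ^+ c.+1).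
Proof.
exists ((-1) ^+ c.+1 *: 'X^c).
rewrite -mul_polyC rmorphM /= map_polyC map_polyXn hornerM hornerC hornerXn /=.
by rewrite rmorphXn rmorphN1 mulrCA -exprS -exprMn mulN1r.
Qed.

Lemma in_qVZqV0 (K : fieldType) (q : K) : in_qVZqV q 0.
Proof. by exists 0; rewrite rmorph0 horner0 mulr0. Qed.

Lemma weight_top_word (K : fieldType) (q : K) : weight k q D (top_word k D) = 1.
Proof.
rewrite weightE // compatible_top_word (_ : [set v | _] = set0) ?cards0 //.
by apply/setP=> v; rewrite !inE bsign_top_word // andbN.
Qed.

(** At a compatible word the weight is a power of -q^-1, whose exponent is the
    number of opening ends with sign -; without such ends the word is the top word
    itself. *)
Lemma diagram_vec_triangular (K : fieldType) (q : K) u :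
  let r := (diagram_vec k q D - vecs K (top_word k D)) u in
  in_qVZqV q r /\
  (r != 0 -> psum u n = psum (top_word k D) n /\
             forall m, (1 <= m <= n)%N -> psum (top_word k D) m <= psum u m).
Proof.
move=> r; rewrite /r !ffunE; case: (eqVneq u (top_word k D)) => [->|uw].
  by rewrite weight_top_word subrr eqxx; split=> //; apply: in_qVZqV0.
rewrite subr0 weightE //; case: ifP => [cu|_]; last first.
  by rewrite eqxx; split=> //; apply: in_qVZqV0.
split=> [|_]; last by split=> [|m _]; [apply: psum_total | apply: psum_le].
rewrite -(@prednK #|_|); first exact: in_qVZqV_opp_exp.
rewrite card_gt0; apply: contraNneq uw => e0.
apply/eqP/eq_from_tnth => j; rewrite tnth_mktuple.
have bsign_open v : opens k D v -> bsign k u v.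
  move=> ov; have := in_set0 v; rewrite -e0 inE ov /= => /negbFE; exact.
move/compatibleP: cu => cu.
case o: (opens k D (true, j)); first exact: (bsign_open _ o).
have := bsign_open (D (true, j)); rewrite opensN // o cu /bsign /= => /(_ isT).
exact: negbTE.
Qed.
End Triangular.

Theorem theorem8p7 (R : realType) (n k : nat)
    (rho : {linear TL (groundField R) n -> 'End(Vt (groundField R) n)})
    (D : diagram n) :
  (k <= n)%N ->
  is_TL_action (q R) rho ->
  diagrammatic_basis k D ->
  let b := ind_embedding rho k (dg (groundField R) D) in
  (exists w : n.-tuple bool, dual_canonical (q R) (@bar R) w b) /\
  b = \sum_(I in transversals D) sgnT (q R) D I *: vT (groundField R) k D I.
Proof.
move=> kn act bD b.
have oD := basis_oriented kn bD.
have [bE psiE] := ind_embedding_basis (bar := @bar R) kn (q_neq0 R) (bar_q R) act bD.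
rewrite /b bE; split; last exact: diagram_vec_transversals.
exists (top_word k D); split; first exact: psiE.
exact: diagram_vec_triangular.
Qed.
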